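(* Let $\mathbb{K}=\mathbb{R}$ or $\mathbb{C}$, let $1\le p<\infty$, and let $(X,\mu,f)$ be an odometer system such that the composition operator $T_f:L^p(X;\mathbb{K})\to L^p(X;\mathbb{K})$, $T_f(\varphi)=\varphi\circ f$, is continuous. Then the following are equivalent: (1) $T_f$ is Li--Yorke chaotic; (2) $T_f$ is supercyclic; (3) $T_f$ is hypercyclic; (4) $T_f$ is Devaney chaotic.
   Context: Odometer system. Let $(\alpha_n)_{n\ge1}$ be a sequence of integers with $\alpha_n\ge2$ for all $n$, let $A_n=\{0,\ldots,\alpha_n-1\}$ and let $X=\prod_{n=1}^\infty A_n$ with the product topology and its Borel $\sigma$-algebra $\mathcal{B}$. The odometer $f:X\to X$ is defined as follows: $f(\alpha_1-1,\alpha_2-1,\alpha_3-1,\ldots)=(0,0,0,\ldots)$, and for any other $x=(x_1,x_2,\ldots)$, with $l(x)=\min\{j\ge1:x_j\ne\alpha_j-1\}$, one sets $f(x)_n=0$ if $n<l(x)$, $f(x)_n=x_n+1$ if $n=l(x)$, and $f(x)_n=x_n$ if $n>l(x)$. For each $n\ge1$ let $\mu_n$ be a probability measure on $A_n$ with $\mu_n(a)>0$ for all $a\in A_n$, let $\mu=\prod_{n=1}^\infty\mu_n$ be the product probability on $X$, and assume $\prod_{n=1}^\infty\max\{\mu_n(a):a\in A_n\}=0$ (so $\mu$ is non-atomic). Any such triple $(X,\mu,f)$ is called an odometer system. $L^p(X;\mathbb{K})$ is taken with respect to $\mu$. Continuity of $T_f$ means that $\varphi\mapsto\varphi\circ f$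 is a bounded linear operator of $L^p(X;\mathbb{K})$ into itself. For a continuous linear operator $T$ on a separable Banach space $\mathcal{X}$ over $\mathbb{K}$: - $T$ is Li--Yorke chaotic if there is $x\in\mathcal{X}$ with $\liminf_{n\to\infty}\|T^nx\|=0$ and $\limsup_{n\to\infty}\|T^nx\|=\infty$; - $T$ is supercyclic if there is $x\in\mathcal{X}$ such that $\{\lambda T^nx:\lambda\in\mathbb{K},\,n\ge1\}$ is dense in $\mathcal{X}$; - $T$ is hypercyclic if there is $x\in\mathcal{X}$ such that $\{T^nx:n\ge1\}$ is dense in $\mathcal{X}$; - $T$ is Devaney chaotic if it is hypercyclic and its set of periodic points (vectors $x$ with $T^nx=x$ for some $n\ge1$) is dense in $\mathcal{X}$. *)

(* Defs.v *)
From HB Require Import structures.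
From mathcomp Require Import all_boot all_order all_algebra.
From mathcomp Require Import all_classical all_reals all_analysis.
From mathcomp Require Import measurable_realfun complex ring lra.

Set Implicit Arguments.
Unset Strict Implicit.
Unset Printing Implicit Defensive.

Import Order.TTheory GRing.Theory Num.Theory.
Import numFieldNormedType.Exports.

Local Open Scope classical_set_scope.
Local Open Scope ring_scope.
Local Open Scope quotient_scope.

Variant base_field := RealScalars | ComplexScalars.

Definition scalars (R : realType) (k : base_field) : numFieldType :=
  match k with RealScalars => R | ComplexScalars => R[i] end.

(* The norm of [scalars R k] takes its values in [scalars R k]; [modulus] is the
   same number seen in R, and [of_real] embeds R back. *)
Definition modulus (R : realType) (k : base_field) : scalars R k -> R :=
  match k with
  | RealScalars => fun x : R => `|x|
  | ComplexScalars => fun z : R[i] => complex.Re `|z|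
  end.
Arguments modulus {R k} x.

Definition of_real (R : realType) (k : base_field) : R -> scalars R k :=
  match k with
  | RealScalars => fun x : R => x
  | ComplexScalars => fun x : R => (x%:C)%C
  end.
Arguments of_real {R} k x.

Section scalars_theory.
Context (R : realType) (k : base_field).
Implicit Types (x y : scalars R k) (a b : R).

Lemma of_real_modulus x : of_real k (modulus x) = `|x|.
Proof. by case: k x => [//|/= [u v]]; rewrite normc_def. Qed.

Lemma of_real0 : of_real k (0 : R) = 0.
Proof. by case: k. Qed.

Lemma of_realD a b : of_real k (a + b) = of_real k a + of_real k b.
Proof. by case: k => //=; rewrite rmorphD. Qed.

Lemma of_realM a b : of_real k (a * b) = of_real k a * of_real k b.
Proof. by case: k => //=; rewrite rmorphM. Qed.

Lemma ler_of_real a b : (of_real k a <= of_real k b) = (a <= b).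
Proof. by case: k => //=; rewrite lecR. Qed.

Lemma of_real_inj : injective (@of_real R k).
Proof. by case: k => [//|a b []]. Qed.

Lemma ltr_of_real a b : (of_real k a < of_real k b) = (a < b).
Proof. by rewrite !lt_neqAle ler_of_real (inj_eq of_real_inj). Qed.

Lemma modulus_ge0 x : 0 <= modulus x.
Proof. by rewrite -ler_of_real of_real_modulus of_real0 normr_ge0. Qed.

Lemma modulus0 : modulus (0 : scalars R k) = 0.
Proof. by apply: of_real_inj; rewrite of_real_modulus normr0 of_real0. Qed.

Lemma modulus_eq0 x : modulus x = 0 -> x = 0.
Proof.
move/(congr1 (of_real k)); rewrite of_real_modulus of_real0 => /eqP.
by rewrite normr_eq0 => /eqP.
Qed.

Lemma ler_modulusD x y : modulus (x + y) <= modulus x + modulus y.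
Proof. by rewrite -ler_of_real of_realD !of_real_modulus ler_normD. Qed.

Lemma modulusM x y : modulus (x * y) = modulus x * modulus y.
Proof. by apply: of_real_inj; rewrite of_realM !of_real_modulus normrM. Qed.

Lemma modulusN x : modulus (- x) = modulus x.
Proof. by apply: of_real_inj; rewrite !of_real_modulus normrN. Qed.

Definition rat_point : rat * rat -> scalars R k :=
  match k with
  | RealScalars => fun q => ratr q.1 : R
  | ComplexScalars => fun q => Complex (ratr q.1 : R) (ratr q.2)
  end.

Lemma rat_point_dense x a : 0 < a -> exists q, modulus (x - rat_point q) < a.
Proof.
have dr (u e : R) : 0 < e -> exists q : rat, `|u - ratr q| < e.
  move=> e0; have [|q] := @rat_in_itvoo R (u - e) (u + e); first by lra.
  by rewrite in_itv/= => /andP[q1 q2]; exists q; rewrite ltr_norml; lra.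
rewrite /rat_point; case: k x => /= [x a0|[u v] a0].
  by have [q hq] := dr x a a0; exists (q, 0).
have a20 : 0 < a / 2 by rewrite divr_gt0.
have [q hq] := dr u _ a20; have [r hr] := dr v _ a20; exists (q, r).
rewrite /modulus/=.
rewrite -[ltRHS]gtr0_norm// -sqrtr_sqr ltr_sqrt ?exprn_gt0//.
rewrite -(real_normK (num_real (u - _))) -(real_normK (num_real (v - _))).
have := normr_ge0 (u - ratr q); have := normr_ge0 (v - ratr r).
move: hq hr; set U := `|_|; set V := `|_|; nra.
Qed.

Lemma nbhs_modulusP x (A : set (scalars R k)) :
  nbhs x A <-> exists2 a : R, 0 < a & forall y, modulus (x - y) < a -> A y.
Proof.
split.
- move=> /nbhs_ballP[e/= e0 eA]; exists (modulus e).
    by rewrite -ltr_of_real of_real_modulus of_real0 normr_gt0 gt_eqF.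
  move=> y xy; apply: eA; rewrite -ball_normE/=.
  by rewrite -of_real_modulus -[e]gtr0_norm// -of_real_modulus ltr_of_real.
- move=> [a a0 aA]; apply/nbhs_ballP; exists (of_real k a) => /=.
    by rewrite -of_real0 ltr_of_real.
  move=> y; rewrite -ball_normE/= -of_real_modulus ltr_of_real => xy.
  exact: aA.
Qed.

Lemma open_modulus_ball x a : open [set y | modulus (x - y) < a].
Proof.
rewrite openE => y /= xya; apply/nbhs_modulusP.
exists (a - modulus (x - y)); first by rewrite subr_gt0.
move=> z yz /=.
rewrite (_ : x - z = (x - y) + (y - z)); last by rewrite addrA subrK.
by rewrite (le_lt_trans (ler_modulusD _ _))// -ltrBrDl.
Qed.

Lemma continuous_modulus : continuous (@modulus R k).
Proof.
move=> x A /nbhs_ballP[e/= e0 eA]; apply/nbhs_modulusP; exists e => // y xy.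
apply: eA; rewrite -ball_normE/= ltr_norml; apply/andP; split.
  have := ler_modulusD (y - x) x; rewrite subrK -(opprB x y) modulusN; lra.
have := ler_modulusD (x - y) y; rewrite subrK; lra.
Qed.

End scalars_theory.

(* [scalars R k] carries the topology of its own norm, so this is the Borel
   sigma-algebra of R or of C. *)
Definition borel_scalars (R : realType) (k : base_field) :=
  g_sigma_algebraType (@open (scalars R k)).

Section measurable_scalars.
Context d (T : measurableType d) (R : realType) (k : base_field).
Implicit Types f g : T -> scalars R k.
Local Notation measurableK f :=
  (measurable_fun setT (f : T -> borel_scalars R k)).

Lemma measurable_scalarsP f : measurableK f <->
  forall U : set (scalars R k), open U -> measurable (f @^-1` U).
Proof.
split=> [mf U oU|mf].
  by rewrite -[_ @^-1` _]setTI; apply: mf => //; exact: sub_sigma_algebra.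
apply: (@measurability _ _ T (borel_scalars R k) setT f (@open (scalars R k)))
  => //.
by move=> _ [U oU <-]; rewrite setTI; exact: mf.
Qed.

Lemma measurable_modulus f :
  measurableK f -> measurable_fun setT (fun x => modulus (f x)).
Proof.
move=> /measurable_scalarsP mf.
apply: (measurability _ (measurable_realfun.RGenOInfty.measurableE R)).
move=> _ [_ [a ->] <-]; rewrite setTI.
apply: (mf ((@modulus R k) @^-1` `]a, +oo[)).
apply: open_comp; last exact: interval_open.
by move=> x _; exact: continuous_modulus.
Qed.

Lemma measurable_op2 (h : scalars R k -> scalars R k -> scalars R k) f g :
  continuous (fun z : scalars R k * scalars R k => h z.1 z.2) ->
  measurableK f -> measurableK g ->
  measurableK (fun x => h (f x) (g x)).
Proof.
move=> ch /measurable_scalarsP mf /measurable_scalarsP mg.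
apply/measurable_scalarsP => U oU.
pose B (q : rat * rat) (r : rat) :=
  [set y : scalars R k | modulus (rat_point R k q - y) < ratr r].
pose good (i : (rat * rat) * (rat * rat) * rat) :=
  forall y z, B i.1.1 i.2 y -> B i.1.2 i.2 z -> U (h y z).
rewrite (_ : _ @^-1` U = \bigcup_(i in good)
    (f @^-1` B i.1.1 i.2 `&` g @^-1` B i.1.2 i.2)); last first.
  apply/seteqP; split => [x /= Ux|x [i gi [fx gx]]]; last exact: gi.
  have : nbhs (f x, g x) [set z : scalars R k * scalars R k | U (h z.1 z.2)].
    by apply: ch; exact: open_nbhs_nbhs.
  move=> [[P Q]/= [/nbhs_modulusP[a a0 aP] /nbhs_modulusP[b b0 bQ]] PQ].
  pose m := Num.min a b; have m0 : 0 < m by rewrite lt_min a0.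
  have [|r] := @rat_in_itvoo R 0 (m / 2); first by rewrite divr_gt0.
  rewrite in_itv/= => /andP[r0 rm].
  have [q1 hq1] := rat_point_dense (f x) r0.
  have [q2 hq2] := rat_point_dense (g x) r0.
  have near_m (u v w : scalars R k) :
      modulus (u - w) < ratr r -> modulus (w - v) < ratr r ->
      modulus (u - v) < m.
    move=> uw wv.
    rewrite (_ : u - v = (u - w) + (w - v)); last by rewrite addrA subrK.
    apply: le_lt_trans (ler_modulusD _ _) _; lra.
  exists (q1, q2, r); last first.
    by split; rewrite /B /= -modulusN opprB.
  move=> y z /= yB zB; apply: (PQ (y, z)); split => /=.
    apply: aP; apply: (lt_le_trans (near_m _ _ _ hq1 yB)).
    by rewrite ge_min lexx.
  apply: bQ; apply: (lt_le_trans (near_m _ _ _ hq2 zB)).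
  by rewrite ge_min lexx orbT.
rewrite bigcup_mkcond; apply: countable_bigcupT_measurable => // i.
case: ifP => // _.
by apply: measurableI; [apply: mf|apply: mg]; exact: open_modulus_ball.
Qed.

End measurable_scalars.

Section Lp_functions.
Context d (T : measurableType d) (R : realType) (k : base_field).
Variable mu : {measure set T -> \bar R}.
Implicit Types f g : T -> scalars R k.
Local Notation measurableK f :=
  (measurable_fun setT (f : T -> borel_scalars R k)).

Definition Lpnorm (p : R) (f : T -> scalars R k) : \bar R :=
  ('N[mu]_p%:E[EFin \o (modulus \o f)])%E.

Definition Lpfun (p : R) (p1 : 1 <= p) : {pred T -> scalars R k} :=
  mem [set f | measurableK f /\ (Lpnorm p f < +oo)%E].

Lemma LpfunP p (p1 : 1 <= p) f :
  reflect (measurableK f /\ (Lpnorm p f < +oo)%E) (f \in Lpfun p1).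
Proof. by apply: (iffP idP) => [/set_mem|/mem_set]. Qed.

Lemma LpnormE p f :
  Lpnorm p f = ((\int[mu]_x (modulus (f x) `^ p)%:E) `^ p^-1)%E.
Proof.
rewrite /Lpnorm unlock; apply: (congr1 (fun z => z `^ p^-1)%E).
apply: eq_integral => x _ /=.
by rewrite ger0_norm ?modulus_ge0.
Qed.

Lemma measurable_modulus_powR p f : measurableK f ->
  measurable_fun setT (fun x => modulus (f x) `^ p).
Proof.
move=> /measurable_modulus mf.
exact: (@measurableT_comp _ _ _ _ _ _ (@powR R ^~ p)).
Qed.

Lemma Lpnorm_ge0 p f : (0 <= Lpnorm p f)%E.
Proof. exact: Lnorm_ge0. Qed.

Lemma Lpnorm0 p : 1 <= p -> Lpnorm p (fun=> 0) = 0%E.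
Proof.
move=> p1; rewrite /Lpnorm (@eq_Lnorm _ _ _ _ _ _ (cst 0%E)); last first.
  by move=> x /=; rewrite modulus0.
by rewrite Lnorm0// eqe gt_eqF// (lt_le_trans ltr01).
Qed.

Lemma LpnormD p f g : 1 <= p -> measurableK f -> measurableK g ->
  (Lpnorm p (f \+ g)%R <= Lpnorm p f + Lpnorm p g)%E.
Proof.
move=> p1 mf mg; have p0 : 0 <= p by rewrite (le_trans ler01).
have mfg : measurableK (f \+ g)%R.
  by apply: (measurable_op2 (h := +%R)) => //; exact: add_continuous.
have mf' := measurable_modulus mf; have mg' := measurable_modulus mg.
apply: le_trans (minkowski_EFin mu mf' mg' p1).
rewrite LpnormE unlock.
apply: gt0_ler_poweR; rewrite ?invr_ge0// ?in_itv/= ?leey ?andbT.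
- by apply: integral_ge0 => x _; rewrite lee_fin powR_ge0.
- by apply: integral_ge0 => x _; rewrite lee_fin powR_ge0.
apply: ge0_le_integral => //.
- by move=> x _; rewrite lee_fin powR_ge0.
- by apply/measurable_EFinP; exact: measurable_modulus_powR.
- apply/measurable_EFinP.
  apply: (@measurableT_comp _ _ _ _ _ _ (@powR R ^~ p)) => //.
  by apply: measurableT_comp => //; exact: measurable_funD.
move=> x _ /=; rewrite lee_fin ge0_ler_powR ?nnegrE ?modulus_ge0//.
by rewrite (le_trans (ler_modulusD _ _))// ler_norm.
Qed.

Lemma LpnormZ p a f : 1 <= p -> measurableK f ->
  Lpnorm p (fun x => a * f x)%R = ((modulus a)%:E * Lpnorm p f)%E.
Proof.
move=> p1 mf; have p0 : 0 < p by rewrite (lt_le_trans ltr01).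
rewrite !LpnormE; under eq_integral.
  by move=> x _; rewrite modulusM powRM ?modulus_ge0// EFinM; over.
rewrite ge0_integralZl//; last first.
- by rewrite lee_fin powR_ge0.
- by move=> x _; rewrite lee_fin powR_ge0.
- by apply/measurable_EFinP; exact: measurable_modulus_powR.
rewrite poweRM ?lee_fin ?powR_ge0//; last first.
  by apply: integral_ge0 => x _; rewrite lee_fin powR_ge0.
by rewrite poweR_EFin -powRrM mulfV ?gt_eqF// powRr1// modulus_ge0.
Qed.

Lemma Lpnorm_eq0P p f : 1 <= p -> measurableK f ->
  Lpnorm p f = 0%E <-> {ae mu, forall x, f x = 0}.
Proof.
move=> p1 mf; have p0 : 0 < p by rewrite (lt_le_trans ltr01).
split=> [|f0].
  move=> /Lnorm_eq0_eq0 h; have : (EFin \o (modulus \o f) = \0 %[ae mu])%E.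
    by apply: h => //; apply/measurable_EFinP; exact: measurable_modulus.
  by apply: filterS => x /(_ Logic.I)[/modulus_eq0].
rewrite LpnormE (ae_eq_integral (cst 0%E))//.
- by rewrite integral0 poweR0r// invr_eq0 gt_eqF.
- by apply/measurable_EFinP; exact: measurable_modulus_powR.
by apply: filterS f0 => x -> _; rewrite modulus0 powR0// gt_eqF.
Qed.

Lemma Lpfun_submod_closed p (p1 : 1 <= p) : submod_closed (Lpfun p1).
Proof.
have mscale a f : measurableK f -> measurableK (fun x => a * f x)%R.
  move=> mf; apply: (measurable_op2 (h := *%R) (f := cst a)) => //.
  exact: mul_continuous.
split; first by apply/LpfunP; split; [exact: measurable_cst|rewrite Lpnorm0].
move=> a f g /LpfunP[mf nf] /LpfunP[mg ng]; apply/LpfunP; split.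
  apply: (measurable_op2 (h := +%R)) => //; first exact: add_continuous.
  exact: mscale.
apply: le_lt_trans (LpnormD p1 (mscale a _ mf) mg) _.
rewrite LpnormZ// lte_add_pinfty// lte_mul_pinfty// lee_fin modulus_ge0//.
Qed.

HB.instance Definition _ p (p1 : 1 <= p) :=
  GRing.isSubmodClosed.Build (scalars R k) (T -> scalars R k) (Lpfun p1)
    (Lpfun_submod_closed p1).

Definition Lpfun_type (p : R) (p1 : 1 <= p) :=
  {f : T -> scalars R k | f \in Lpfun p1}.

HB.instance Definition _ p (p1 : 1 <= p) := SubChoice.on (Lpfun_type p1).
HB.instance Definition _ p (p1 : 1 <= p) :=
  [SubChoice_isSubLmodule of Lpfun_type p1 by <:].

(* L^p is the space of p-integrable functions modulo almost everywhere
   equality (see [Lpclass_eqP]); its norm is given by [Lp_norm_class]. *)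
Definition null_Lpfun (p : R) (p1 : 1 <= p) : {pred Lpfun_type p1} :=
  mem [set f : Lpfun_type p1 | {ae mu, forall x, val f x = 0}].
Arguments null_Lpfun {p} p1.

Lemma null_LpfunP p (p1 : 1 <= p) (f : Lpfun_type p1) :
  reflect {ae mu, forall x, val f x = 0} (f \in null_Lpfun p1).
Proof. by apply: (iffP idP) => [/set_mem|/mem_set]. Qed.

Lemma null_Lpfun_submod_closed p (p1 : 1 <= p) : submod_closed (null_Lpfun p1).
Proof.
split; first by apply/null_LpfunP; apply: aeW.
move=> a f g /null_LpfunP f0 /null_LpfunP g0; apply/null_LpfunP.
apply: filterS2 f0 g0 => x fx gx.
have -> : val (a *: f + g) = a *: val f + val g by exact: linearP.
have -> : (a *: val f + val g) x = a * val f x + val g x by [].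
by rewrite fx gx mulr0 addr0.
Qed.

HB.instance Definition _ p (p1 : 1 <= p) :=
  GRing.isSubmodClosed.Build (scalars R k) (Lpfun_type p1) (null_Lpfun p1)
    (null_Lpfun_submod_closed p1).

Definition Lp (p : R) (p1 : 1 <= p) := Quotient.quot (null_Lpfun p1).

HB.instance Definition _ p (p1 : 1 <= p) := GRing.Zmodule.on (Lp p1).
HB.instance Definition _ p (p1 : 1 <= p) := EqQuotient.on (Lp p1).

Definition Lpclass (p : R) (p1 : 1 <= p) (f : Lpfun_type p1) : Lp p1 := \pi f.

End Lp_functions.

Arguments Lp {d T R} k mu {p} p1.
Arguments null_Lpfun {d T R} k mu {p} p1.
Arguments Lpfun_type {d T R} k mu {p} p1.

Section Lp_space.
Context d (T : measurableType d) (R : realType) (k : base_field).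
Variable mu : {measure set T -> \bar R}.
Variables (p : R) (p1 : 1 <= p).
Local Notation K := (scalars R k).
Local Notation LF := (Lpfun_type k mu p1).
Local Notation LP := (Lp k mu p1).
Implicit Types (f g : LF) (u v : LP) (a b : K).

Lemma Lpclass_eqP f g :
  Lpclass f = Lpclass g <-> {ae mu, forall x, val f x = val g x}.
Proof.
split.
  move=> /eqP; rewrite -Quotient.idealrBE => /null_LpfunP.
  apply: filterS => x /eqP; rewrite -[val (f - g) x]/(val f x - val g x).
  by rewrite subr_eq0 => /eqP.
move=> fg; apply/eqP; rewrite -Quotient.idealrBE; apply/null_LpfunP.
by apply: filterS fg => x /eqP; rewrite -subr_eq0 => /eqP.
Qed.

Lemma LpclassK u : Lpclass (repr u) = u.
Proof. exact: reprK. Qed.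

Lemma LpclassD f g : Lpclass (f + g) = Lpclass f + Lpclass g.
Proof. exact: (raddfD \pi_LP). Qed.

Definition Lp_scale a u : LP := Lpclass (a *: repr u).

Lemma Lpclass_scale a f : Lpclass (a *: f) = Lp_scale a (Lpclass f).
Proof.
have /Lpclass_eqP h := esym (LpclassK (Lpclass f)).
by apply/Lpclass_eqP; apply: filterS h => x fx; rewrite -[LHS]/(a * val f x) fx.
Qed.

Fact Lp_scalerA a b u : Lp_scale a (Lp_scale b u) = Lp_scale (a * b) u.
Proof. by rewrite -[u]LpclassK -!Lpclass_scale scalerA. Qed.

Fact Lp_scale1r : left_id 1 Lp_scale.
Proof. by move=> u; rewrite -[u]LpclassK -Lpclass_scale scale1r. Qed.

Fact Lp_scalerDr : right_distributive Lp_scale +%R.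
Proof.
move=> a u v; rewrite -[u]LpclassK -[v]LpclassK -LpclassD -!Lpclass_scale.
by rewrite scalerDr LpclassD.
Qed.

Fact Lp_scalerDl u : {morph Lp_scale^~ u : a b / a + b}.
Proof.
by move=> a b; rewrite -[u]LpclassK -!Lpclass_scale scalerDl LpclassD.
Qed.

HB.instance Definition _ := GRing.Zmodule_isLmodule.Build K LP
  Lp_scalerA Lp_scale1r Lp_scalerDr Lp_scalerDl.

Lemma LpclassZ a f : Lpclass (a *: f) = a *: Lpclass f.
Proof. exact: Lpclass_scale. Qed.

Definition Lp_norm u : K := of_real k (fine (Lpnorm mu p (val (repr u)))).

Lemma Lpfun_fin_num f : Lpnorm mu p (val f) \is a fin_num.
Proof.
have /LpfunP[_ nf] := valP f.
by rewrite ge0_fin_numE// Lpnorm_ge0.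
Qed.

Lemma Lp_norm_class f :
  Lp_norm (Lpclass f) = of_real k (fine (Lpnorm mu p (val f))).
Proof.
have /Lpclass_eqP h := LpclassK (Lpclass f).
have /LpfunP[mf _] := valP f; have /LpfunP[mg _] := valP (repr (Lpclass f)).
rewrite /Lp_norm; congr (of_real k (fine _)); rewrite !LpnormE.
apply: (congr1 (fun z => z `^ p^-1)%E); apply: ae_eq_integral => //.
- by apply/measurable_EFinP; exact: measurable_modulus_powR.
- by apply/measurable_EFinP; exact: measurable_modulus_powR.
by apply: filterS h => x -> _.
Qed.

Lemma ler_Lp_normD u v : Lp_norm (u + v) <= Lp_norm u + Lp_norm v.
Proof.
rewrite -[u]LpclassK -[v]LpclassK -LpclassD !Lp_norm_class -of_realD.
rewrite ler_of_real.
rewrite -fineD ?Lpfun_fin_num//.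
apply: fine_le; rewrite ?fin_numD ?Lpfun_fin_num//.
have /LpfunP[mf _] := valP (repr u); have /LpfunP[mg _] := valP (repr v).
exact: LpnormD.
Qed.

Lemma Lp_normZ a u : Lp_norm (a *: u) = `|a| * Lp_norm u.
Proof.
rewrite -[u]LpclassK -LpclassZ !Lp_norm_class -of_real_modulus -of_realM.
have /LpfunP[mf _] := valP (repr u).
rewrite -[X in Lpnorm _ _ X]/(fun x => a * val (repr u) x) LpnormZ//.
by rewrite fineM ?Lpfun_fin_num.
Qed.

Lemma Lp_norm_eq0 u : Lp_norm u = 0 -> u = 0.
Proof.
rewrite -[u]LpclassK Lp_norm_class -of_real0 => /of_real_inj nu0.
have /LpfunP[mf _] := valP (repr u).
have /(Lpnorm_eq0P mu p1 mf) u0 : Lpnorm mu p (val (repr u)) = 0%E.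
  by rewrite -[LHS]fineK ?Lpfun_fin_num// nu0.
rewrite -[RHS](raddf0 \pi_LP); apply/Lpclass_eqP.
by apply: filterS u0 => x ->.
Qed.

HB.instance Definition _ := Lmodule_isNormed.Build K LP
  ler_Lp_normD Lp_normZ Lp_norm_eq0.

End Lp_space.

(* [Tf] is the operator [g |-> g \o f] on L^p: for every representative [g] of
   every class, [g \o f] is p-integrable and its class is the image of the class
   of [g]. In particular [g \o f] does not depend, up to a null set, on the
   representative. *)
Definition is_composition_operator d (T : measurableType d) (R : realType)
    (k : base_field) (mu : {measure set T -> \bar R}) (p : R) (p1 : 1 <= p)
    (f : T -> T) (Tf : Lp k mu p1 -> Lp k mu p1) : Prop :=
  forall g : Lpfun_type k mu p1, exists h : Lpfun_type k mu p1,
    val h = val g \o f /\ Tf (Lpclass g) = Lpclass h.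

Section linear_dynamics.
Context (R : realType) (k : base_field) (V : normedModType (scalars R k)).
Implicit Types T : V -> V.

Definition Li_Yorke_chaotic T : Prop :=
  exists x : V,
    limn_einf (fun n => (modulus `|iter n T x|)%:E) = 0%E /\
    limn_esup (fun n => (modulus `|iter n T x|)%:E) = +oo%E.

Definition supercyclic T : Prop :=
  exists x : V, dense
    [set y : V | exists (l : scalars R k) (n : nat),
       (1 <= n)%N /\ y = l *: iter n T x].

Definition hypercyclic T : Prop :=
  exists x : V, dense [set iter n T x | n in [set n | (1 <= n)%N]].

Definition periodic_point T (x : V) : Prop :=
  exists n : nat, (1 <= n)%N /\ iter n T x = x.

Definition Devaney_chaotic T : Prop :=
  hypercyclic T /\ dense [set x : V | periodic_point T x].

End linear_dynamics.

(* Coordinates are indexed from 0: [alpha n] is the classical alpha_(n+1). The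
   hypothesis on [alpha] is a parameter of [digit] because measurable types must
   be inhabited. *)
Section odometer.
Context (alpha : nat -> nat) (alpha_ge2 : forall n, (2 <= alpha n)%N).

Definition digit of (forall n, (2 <= alpha n)%N) := fun n : nat => 'I_(alpha n).

Definition zero_digit (n : nat) : digit alpha_ge2 n :=
  Ordinal (ltnW (alpha_ge2 n)).

HB.instance Definition _ (n : nat) := Finite.on (digit alpha_ge2 n).
HB.instance Definition _ (n : nat) :=
  isPointed.Build (digit alpha_ge2 n) (zero_digit n).
HB.instance Definition _ (n : nat) :=
  @isMeasurable.Build default_measure_display (digit alpha_ge2 n)
    discrete_measurable discrete_measurable0
    discrete_measurableC discrete_measurableU.

Definition digit_sequences :=
  prod_topology (fun n => discrete_topology (digit alpha_ge2 n)).

HB.instance Definition _ := Topological.on digit_sequences.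
HB.instance Definition _ := Pointed.on digit_sequences.

(* The Borel sigma-algebra of the product topology. *)
Definition odometer_space := g_sigma_algebraType (@open digit_sequences).

HB.instance Definition _ := Measurable.on odometer_space.

(* [l] is the first coordinate that is not maximal; there [insubd] returns
   [(x l).+1], which is smaller than [alpha l]. *)
Definition odometer (x : odometer_space) : odometer_space :=
  match pselect (exists j, (x j : nat) != (alpha j).-1) with
  | left nonmax => let l := ex_minn nonmax in
      fun n => if (n < l)%N then zero_digit n
               else if n == l then insubd (zero_digit n) (x n).+1
               else x n
  | right _ => zero_digit
  end.

(* The values on measurable rectangles determine the product probability. *)
Definition is_product_probability (R : realType)
    (m : forall n, probability (digit alpha_ge2 n) R)
    (mu : probability odometer_space R) : Prop :=
  forall (n : nat) (B : forall i, set (digit alpha_ge2 i)),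
    mu [set x | forall i, (i < n)%N -> B i (x i)] =
    (\prod_(i < n) m i (B i))%E.

End odometer.

Arguments odometer {alpha} alpha_ge2 x.

(* Main.v *)
Require Import Defs.
From HB Require Import structures.
From mathcomp Require Import all_boot all_order all_algebra.
From mathcomp Require Import all_classical all_reals all_analysis.
From mathcomp Require Import measurable_realfun ring lra zify.

Set Implicit Arguments.
Unset Strict Implicit.
Unset Printing Implicit Defensive.

Import Order.TTheory GRing.Theory Num.Theory.
Import numFieldNormedType.Exports.

Local Open Scope classical_set_scope.
Local Open Scope ring_scope.

(** Why the four notions coincide.  Write f for the odometer and say that a
set B is vanishing when the measures of its preimages under the iterates of
f come arbitrarily close to 0.  The whole theorem turns on one condition:
some vanishing set has positive measure.

Each of Li-Yorke chaos and supercyclicity yields such a set.  A Li-Yorke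
vector is nonzero and the norms along its orbit come arbitrarily close to 0, so
by Markov's inequality a set on which its modulus stays away from 0 is
vanishing ([small_orbit_vanishing]).  For a supercyclic vector g, take a set of
positive measure on which the modulus of g varies by a factor less than 2, and
approximate, by multiples of the orbit of g, a function which takes a different
power of 8 on each cylinder of a given depth.  Up to a small error, the preimage of that
set under the corresponding iterate lies in a single cylinder, whose measure
is small because mu is non-atomic ([supercyclic_vanishing]).

Conversely, a vanishing set of positive measure makes the operator
hypercyclic, in three stages.

First, it can be enlarged to have measure close to 1
([vanishing_large]).  By a density theorem, the set fills almost all of some
cylinder; copying its trace on this cylinder to all cylinders of the same
depth gives a set of measure almost 1, since mu is a product.  The odometer
permutes these cylinders cyclically and changes nothing beyond their depth
except when it wraps around, so the preimages of the enlarged set are covered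
by boundedly many preimages of the original one, and these remain small
because the continuity of the operator makes f uniformly nonsingular.

Second, there are an n and sets D, E such that D and the n-th preimage of E
are small while E and the n-th preimage of D are large
([transitive_sets]).  The set E is a large vanishing set; D is the k-th
preimage, of small measure, of a large set depending on finitely many
digits.  That set is periodic under f, so if n is congruent to -k modulo its
period then the n-th preimage of D is that large set again.

Third, these sets give transitivity by cutting functions off.  To pass from a
bounded u to the vicinity of a function w of finitely many digits, take u on E
plus, on D, a translate w' of w along the orbit such that pulling it back n
times gives w ([vanishing_hypercyclic]).  A hypercyclic vector is then the
limit of successive such corrections ([hypercyclic_of_transitive]); since each
correction changes the function only on a small set, the sequence is almost
everywhere eventually constant, and its pointwise limit is also its limit in
Lp ([stationary_limit]).

Finally, a function of finitely many digits is a periodic point, and these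
functions are dense, so the periodic points are always dense and
hypercyclicity is already Devaney chaos.  Hypercyclicity in turn implies
supercyclicity and Li-Yorke chaos by elementary arguments in any nonzero
normed space. *)

(** * Real-valued norms *)

Lemma modulus1 (R : realType) (k : base_field) :
  modulus (1 : scalars R k) = 1 :> R.
Proof.
by apply: (@of_real_inj R k); rewrite of_real_modulus normr1; case: (k).
Qed.

Section real_norm.
Context (R : realType) (k : base_field) (V : normedModType (scalars R k)).
Implicit Types (u v w : V) (a : scalars R k).

(** The norm of a module over [scalars R k] takes its values in the field of
scalars; estimates are easier with real numbers. *)
Definition nrm u : R := modulus `|u|.

Lemma of_real_nrm u : of_real k (nrm u) = `|u|.
Proof. by rewrite of_real_modulus normr_id. Qed.

Lemma nrm_ge0 u : 0 <= nrm u.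
Proof. exact: modulus_ge0. Qed.

Lemma nrm0 : nrm 0 = 0.
Proof. by rewrite /nrm normr0 modulus0. Qed.

Lemma nrm_eq0 u : nrm u = 0 -> u = 0.
Proof. by move=> /modulus_eq0 /eqP; rewrite normr_eq0 => /eqP. Qed.

Lemma nrmN u : nrm (- u) = nrm u.
Proof. by rewrite /nrm normrN. Qed.

Lemma nrmB u v : nrm (u - v) = nrm (v - u).
Proof. by rewrite -nrmN opprB. Qed.

Lemma nrmZ a u : nrm (a *: u) = modulus a * nrm u.
Proof.
by apply: (@of_real_inj R k); rewrite of_realM !of_real_nrm of_real_modulus normrZ.
Qed.

Lemma ler_nrmD u v : nrm (u + v) <= nrm u + nrm v.
Proof. by rewrite -(@ler_of_real R k) of_realD !of_real_nrm ler_normD. Qed.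

Lemma ler_nrm_triangle u v w : nrm (u - w) <= nrm (u - v) + nrm (v - w).
Proof. by rewrite (le_trans _ (ler_nrmD _ _))// addrA subrK. Qed.

Lemma nbhs_nrmP u (A : set V) :
  nbhs u A <-> exists2 e : R, 0 < e & forall v, nrm (v - u) < e -> A v.
Proof.
split=> [/nbhs_ballP[e/= e0 eA]|[e e0 eA]].
  exists (modulus e).
    by rewrite -(@ltr_of_real R k) of_real_modulus of_real0 normr_gt0 gt_eqF.
  move=> v vu; apply: eA; rewrite -ball_normE/= distrC -of_real_nrm.
  by rewrite -[e]gtr0_norm// -of_real_modulus ltr_of_real.
apply/nbhs_ballP; exists (of_real k e) => /=.
  by rewrite -(@of_real0 R k) ltr_of_real.
move=> v; rewrite -ball_normE/= distrC -of_real_nrm ltr_of_real; exact: eA.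
Qed.

Lemma dense_nrmP (A : set V) :
  dense A <-> forall u (e : R), 0 < e -> exists2 v, A v & nrm (v - u) < e.
Proof.
split=> [dA u e e0|hA U [u Uu] oU].
  have bu : nbhs u [set v | nrm (v - u) < e] by apply/nbhs_nrmP; exists e.
  have [|v [/interior_subset vu Av]] := dA _ _ (open_interior [set v | nrm (v - u) < e]).
    by exists u.
  by exists v.
have /nbhs_nrmP[e e0 eU] : nbhs u U by exact: open_nbhs_nbhs.
by have [v Av /eU Uv] := hA u e e0; exists v.
Qed.

Lemma continuous_nrmP (T : V -> V) :
  continuous T <-> forall u (e : R), 0 < e ->
    exists2 r : R, 0 < r & forall v, nrm (v - u) < r -> nrm (T v - T u) < e.
Proof.
split=> [cT u e e0|hT u A /nbhs_nrmP[e e0 eA]].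
  have : nbhs (T u) [set v | nrm (v - T u) < e] by apply/nbhs_nrmP; exists e.
  by move=> /cT /nbhs_nrmP.
apply/nbhs_nrmP; have [r r0 hr] := hT u e e0.
by exists r => // v /hr /eA.
Qed.

Lemma continuous_iter (T : V -> V) n : continuous T -> continuous (iter n T).
Proof.
move=> cT; elim: n => [|n IH] u; first exact: cvg_id.
by apply: (@continuous_comp _ _ _ (iter n T) T); [exact: IH|exact: cT].
Qed.

End real_norm.

(** * Functions and their classes in Lp *)

Section Lp_tools.
Context d (T : measurableType d) (R : realType) (k : base_field).
Context (mu : probability T R) (p : R) (p1 : 1 <= p).
Local Notation K := (scalars R k).
Local Notation LF := (Lpfun_type k mu p1).
Local Notation LP := (Lp k mu p1).
Local Notation measurableK g :=
  (measurable_fun setT (g : T -> borel_scalars R k)).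
Implicit Types (g h : T -> K) (u v : LP) (E B : set T).

Let p_gt0 : 0 < p. Proof. exact: lt_le_trans ltr01 p1. Qed.

(** Total in [g], so that classes of explicit functions can be written without
a membership proof inside the term; only meaningful on [Lpfun]. *)
Definition Lpof g : LP := Lpclass (insubd (0 : LF) g).

Lemma val_Lpof g : g \in Lpfun mu p1 -> val (insubd (0 : LF) g) = g.
Proof. by move=> gL; rewrite insubdK. Qed.

Lemma Lpof_val (f : LF) : Lpof (val f) = Lpclass f.
Proof. by rewrite /Lpof valKd. Qed.

Lemma LpofP u : exists2 g, g \in Lpfun mu p1 & u = Lpof g.
Proof.
exists (val (repr u)); first exact: valP.
by rewrite Lpof_val LpclassK.
Qed.

Lemma LpofD a g h : g \in Lpfun mu p1 -> h \in Lpfun mu p1 ->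
  Lpof (a *: g + h) = a *: Lpof g + Lpof h.
Proof.
move=> gL hL; rewrite /Lpof -LpclassZ -LpclassD; congr Lpclass.
apply: val_inj; rewrite val_Lpof ?rpredD ?rpredZ//.
have -> (f f' : LF) : val (a *: f + f') = a *: val f + val f' by exact: linearP.
by rewrite !val_Lpof.
Qed.

Lemma LpofB g h : g \in Lpfun mu p1 -> h \in Lpfun mu p1 ->
  Lpof (g - h) = Lpof g - Lpof h.
Proof.
move=> gL hL; rewrite [g - h]addrC -scaleN1r LpofD//.
by rewrite scaleN1r addrC.
Qed.

Lemma Lpof0 : Lpof 0 = 0.
Proof. by rewrite -(subrr (0 : T -> K)) LpofB ?rpred0// subrr. Qed.

Lemma nrm_Lpof g : g \in Lpfun mu p1 ->
  nrm (Lpof g) = fine (Lpnorm mu p g).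
Proof.
move=> gL; apply: (@of_real_inj R k).
by rewrite /nrm of_real_modulus normr_id /Lpof -[LHS]/(Lp_norm _) Lp_norm_class val_Lpof.
Qed.

Local Notation pint g := (\int[mu]_x (modulus (g x) `^ p)%:E)%E.

Lemma pint_ge0 g : (0 <= pint g)%E.
Proof. by apply: integral_ge0 => x _; rewrite lee_fin powR_ge0. Qed.

Lemma poweR_invp_le (x y : \bar R) : (0 <= x)%E -> (0 <= y)%E ->
  (x `^ p^-1 <= y)%E = (x <= y `^ p)%E.
Proof.
move=> x0 y0; have pV : 0 <= p^-1 by rewrite invr_ge0 ltW.
have in0y (z : \bar R) : (0 <= z)%E -> z \in `[0%E, +oo%E].
  by move=> z0; rewrite in_itv/= z0 leey.
apply/idP/idP => h.
  have := gt0_ler_poweR (ltW p_gt0) (in0y _ (poweR_ge0 x p^-1)) (in0y _ y0) h.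
  by rewrite -poweRrM mulVf ?gt_eqF// poweRe1.
have := gt0_ler_poweR pV (in0y _ x0) (in0y _ (poweR_ge0 y p)) h.
by rewrite -poweRrM mulfV ?gt_eqF// poweRe1.
Qed.

Lemma poweR_invp_lt (x y : \bar R) : (0 <= x)%E -> (0 <= y)%E ->
  (x `^ p^-1 < y)%E = (x < y `^ p)%E.
Proof.
move=> x0 y0; have pV : 0 <= p^-1 by rewrite invr_ge0 ltW.
have in0y (z : \bar R) : (0 <= z)%E -> z \in `[0%E, +oo%E].
  by move=> z0; rewrite in_itv/= z0 leey.
rewrite !ltNge; congr (~~ _); apply/idP/idP => h.
  have := gt0_ler_poweR (ltW p_gt0) (in0y _ y0) (in0y _ (poweR_ge0 x p^-1)) h.
  by rewrite -poweRrM mulVf ?gt_eqF// poweRe1.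
have := gt0_ler_poweR pV (in0y _ (poweR_ge0 y p)) (in0y _ x0) h.
by rewrite -poweRrM mulfV ?gt_eqF// poweRe1.
Qed.

Lemma nrm_lt g (e : R) : g \in Lpfun mu p1 -> 0 <= e ->
  (nrm (Lpof g) < e) = (pint g < (e `^ p)%:E)%E.
Proof.
move=> gL e0; rewrite nrm_Lpof// -lte_fin fineK; last first.
  by rewrite -(val_Lpof gL) Lpfun_fin_num.
by rewrite LpnormE poweR_invp_lt ?pint_ge0.
Qed.

Lemma nrm_le g (e : R) : g \in Lpfun mu p1 -> 0 <= e ->
  (nrm (Lpof g) <= e) = (pint g <= (e `^ p)%:E)%E.
Proof.
move=> gL e0; rewrite nrm_Lpof// -lee_fin fineK; last first.
  by rewrite -(val_Lpof gL) Lpfun_fin_num.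
by rewrite LpnormE poweR_invp_le ?pint_ge0.
Qed.

Lemma LpfunE g : measurableK g -> (pint g < +oo)%E -> g \in Lpfun mu p1.
Proof.
move=> mg ig; apply/LpfunP; split => //.
by rewrite LpnormE poweR_lty.
Qed.

Lemma Lpfun_measurable g : g \in Lpfun mu p1 -> measurableK g.
Proof. by move=> /LpfunP[]. Qed.

Lemma measurable_pint g : measurableK g ->
  measurable_fun setT (fun x => (modulus (g x) `^ p)%:E).
Proof. by move=> mg; apply/measurable_EFinP; exact: measurable_modulus_powR. Qed.

Lemma Lpfun_pint g : g \in Lpfun mu p1 -> (pint g < +oo)%E.
Proof.
move=> /LpfunP[_]; rewrite LpnormE => h.
by apply: lty_poweRy h; rewrite invr_eq0 gt_eqF.
Qed.

Lemma pint_supported g (M : R) E : 0 <= M -> measurableK g -> measurable E ->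
  (forall x, modulus (g x) <= M) -> (forall x, ~ E x -> g x = 0) ->
  (pint g <= (M `^ p)%:E * mu E)%E.
Proof.
move=> M0 mg mE gM g0.
rewrite -integral_cst// [leRHS]integral_mkcond.
apply: ge0_le_integral => //.
- by move=> x _; rewrite lee_fin powR_ge0.
- exact: measurable_pint.
- by apply/(measurable_restrict _ _ _) => //; rewrite setTI; exact: measurable_cst.
move=> x _; rewrite patchE; case: ifPn => [_|xE].
  by rewrite lee_fin ge0_ler_powR ?nnegrE ?modulus_ge0// ltW.
rewrite g0; last by move: xE; rewrite notin_setE.
by rewrite modulus0 powR0// gt_eqF.
Qed.

Lemma bounded_Lpfun g (M : R) : measurableK g ->
  (forall x, modulus (g x) <= M) -> g \in Lpfun mu p1.
Proof.
move=> mg gM; apply: LpfunE => //.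
have M0 : 0 <= M by apply: le_trans (gM point); exact: modulus_ge0.
apply: le_lt_trans (pint_supported (E := setT) M0 mg measurableT gM _) _.
  by move=> x /(_ Logic.I).
by rewrite probability_setT mule1 ltry.
Qed.

Lemma nrm_bounded g (M : R) : measurableK g ->
  (forall x, modulus (g x) <= M) -> nrm (Lpof g) <= M.
Proof.
move=> mg gM.
have M0 : 0 <= M by apply: le_trans (gM point); exact: modulus_ge0.
rewrite nrm_le//; last exact: bounded_Lpfun gM.
apply: le_trans (pint_supported (E := setT) M0 mg measurableT gM _) _.
  by move=> x /(_ Logic.I).
by rewrite probability_setT mule1.
Qed.

(** For uniformly bounded functions, convergence to 0 in measure of the support
forces convergence to 0 in norm.  With [small_norm_small_set], this lets the
dynamics be studied on sets instead of functions. *)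
Lemma small_support_small_norm (M e : R) : 0 <= M -> 0 < e ->
  exists2 r : R, 0 < r & forall g E, measurableK g -> measurable E ->
    (mu E < r%:E)%E -> (forall x, modulus (g x) <= M) ->
    (forall x, ~ E x -> g x = 0) -> nrm (Lpof g) < e.
Proof.
move=> M0 e0; have M1 : 0 < (M + 1) `^ p by rewrite powR_gt0// ltr_wpDl.
(* M + 1 instead of M, which may vanish *)
exists (e `^ p / (M + 1) `^ p); first by rewrite divr_gt0// powR_gt0.
move=> g E mg mE Er gM g0; rewrite nrm_lt ?ltW//; last exact: bounded_Lpfun gM.
have gM1 x : modulus (g x) <= M + 1 by rewrite (le_trans (gM x))// lerDl.
have M10 : 0 <= M + 1 by rewrite addr_ge0.
apply: le_lt_trans (pint_supported M10 mg mE gM1 g0) _.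
by rewrite muleC -lte_pdivlMr// -EFinM.
Qed.

Lemma measurable_modulus_ge g (c : R) : measurableK g ->
  measurable [set x | c <= modulus (g x)].
Proof.
move=> /measurable_modulus mg.
have := mg measurableT _ (measurable_itv `[c, +oo[); rewrite setTI.
by congr measurable; apply/seteqP; split => x /=; rewrite in_itv/= andbT.
Qed.

(** Markov's inequality. *)
Lemma small_norm_small_set (c e : R) : 0 < c -> 0 < e ->
  exists2 r : R, 0 < r & forall g, g \in Lpfun mu p1 -> nrm (Lpof g) < r ->
    (mu [set x | (c <= modulus (g x))%R] < e%:E)%E.
Proof.
move=> c0 e0; have cp : 0 < c `^ p by rewrite powR_gt0.
exists (c * e `^ p^-1); first by rewrite mulr_gt0// powR_gt0.
move=> g gL; rewrite nrm_lt//; last by rewrite mulr_ge0 ?powR_ge0// ltW.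
rewrite powRM ?powR_ge0 ?ltW// -powRrM mulVf ?gt_eqF// powRr1 ?ltW// => h.
have mg := Lpfun_measurable gL.
set E := [set x | _]; have mE : measurable E by exact: measurable_modulus_ge.
suff : ((c `^ p)%:E * mu E < (c `^ p)%:E * e%:E)%E.
  by move: (mu E) => z; rewrite lte_pmul2l// lte_fin.
apply: le_lt_trans h; rewrite -(integral_cst mu mE).
have Gge0 x : [set: T] x -> (0 <= (modulus (g x) `^ p)%:E)%E.
  by move=> _; rewrite lee_fin powR_ge0.
have mG := measurable_pint mg.
apply: le_trans (ge0_subset_integral mu mE measurableT mG Gge0 (@subsetT _ E)).
apply: (ge0_le_integral _ mE); last first.
- by move=> x Ex; rewrite lee_fin ge0_ler_powR ?nnegrE ?modulus_ge0//; exact: ltW.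
- by apply: measurable_funTS.
- exact: measurable_cst.
- by move=> x _; rewrite lee_fin powR_ge0.
Qed.

Lemma cst1_Lpfun : cst (1 : K) \in Lpfun mu p1.
Proof.
apply: (@bounded_Lpfun _ 1) => [|x]; first exact: measurable_cst.
by rewrite modulus1.
Qed.

Lemma Lpof1_neq0 : Lpof (cst (1 : K)) != 0.
Proof.
apply/eqP => one0; have [r r0 hr] := small_norm_small_set ltr01 ltr01.
have := hr _ cst1_Lpfun; rewrite one0 nrm0 => /(_ r0).
rewrite (_ : [set x | _] = setT) ?probability_setT ?ltxx//.
by apply/seteqP; split => // x _ /=; rewrite modulus1.
Qed.

Definition cut (F : set T) g : T -> K := fun x => if x \in F then g x else 0.

Lemma cut_in F g x : F x -> cut F g x = g x.
Proof. by move=> Fx; rewrite /cut mem_set. Qed.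

Lemma cut_out F g x : ~ F x -> cut F g x = 0.
Proof. by move=> Fx; rewrite /cut memNset. Qed.

Lemma measurable_cut F g : measurable F -> measurableK g ->
  measurableK (cut F g).
Proof.
move=> mF /measurable_scalarsP mg; apply/measurable_scalarsP => U oU.
rewrite (_ : _ @^-1` U = (F `&` g @^-1` U) `|` (~` F `&` [set _ | U 0])).
  apply: measurableU; apply: measurableI => //; [exact: mg|exact: measurableC|].
  have [U0|U0] := pselect (U 0).
    by rewrite (_ : [set _ | _] = setT)//; apply/seteqP; split.
  by rewrite (_ : [set _ | _] = set0)//; apply/seteqP; split.
apply/seteqP; split => x /=.
  have [Fx|Fx] := pselect (F x); first by rewrite cut_in//; left.
  by rewrite cut_out//; right.
by move=> [[Fx]|[Fx]]; [rewrite cut_in|rewrite cut_out].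
Qed.

Lemma modulus_cut F g x : modulus (cut F g x) <= modulus (g x).
Proof. by rewrite /cut; case: ifP => // _; rewrite modulus0 modulus_ge0. Qed.

Lemma cut_Lpfun F g : measurable F -> g \in Lpfun mu p1 ->
  cut F g \in Lpfun mu p1.
Proof.
move=> mF gL; have mg := Lpfun_measurable gL.
apply: LpfunE; first exact: measurable_cut.
apply: le_lt_trans (Lpfun_pint gL); apply: ge0_le_integral => //.
- by move=> x _; rewrite lee_fin powR_ge0.
- by apply: measurable_pint; exact: measurable_cut.
- exact: measurable_pint.
move=> x _; rewrite lee_fin ge0_ler_powR ?nnegrE ?modulus_ge0 ?modulus_cut//.
exact: ltW.
Qed.

(** Dominated convergence: each point leaves the sets [F n] for good, so the
p-th powers of the truncations tend to 0 pointwise. *)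
Lemma Lp_tail g (F : nat -> set T) (e : R) : g \in Lpfun mu p1 ->
  (forall n, measurable (F n)) -> (forall x, exists N, forall n, (N <= n)%N -> ~ F n x) ->
  0 < e -> exists n, nrm (Lpof (cut (F n) g)) < e.
Proof.
move=> gL mF F0 e0; have mg := Lpfun_measurable gL.
pose f_ n x := (modulus (cut (F n) g x) `^ p)%:E.
have mf_ n : measurable_fun setT (f_ n).
  by apply: measurable_pint; exact: measurable_cut.
pose G x := (modulus (g x) `^ p)%:E.
have G0 x : (0 <= G x)%E by rewrite lee_fin powR_ge0.
have iG : mu.-integrable setT G.
  apply/integrableP; split; first exact: measurable_pint.
  by under eq_integral do rewrite gee0_abs//; exact: Lpfun_pint.
have f_0 : {ae mu, forall x, [set: T] x -> f_ ^~ x @ \oo --> 0%E}.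
  apply: aeW => x _; have [N FN] := F0 x; apply: cvg_near_cst.
  exists N => // n /= /FN Fnx.
  by rewrite /f_ cut_out// modulus0 powR0// gt_eqF.
have f_G : {ae mu, forall x n, [set: T] x -> (`|f_ n x| <= G x)%E}.
  apply: aeW => x n _; rewrite gee0_abs ?lee_fin ?powR_ge0//.
  by rewrite ge0_ler_powR ?nnegrE ?modulus_ge0 ?modulus_cut// ltW.
have [_ _] := dominated_convergence measurableT mf_ (measurable_cst _) f_0 iG f_G.
rewrite integral0 => h.
have ep : (0 < (e `^ p)%:E)%E by rewrite lte_fin powR_gt0.
have [n _ /(_ n (leqnn n))/= hn] := h _ (open_ereal_lt' ep).
by exists n; rewrite nrm_lt ?cut_Lpfun// ltW.
Qed.

(** The closure of [S] contains the multiples of indicators.  Pick a countable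
dense set of scalars and send each point to the first scalar of the list close
to the value of [g] there; stopping after finitely many scalars gives a finite
combination of indicators which is uniformly close to [g] off a set [F N] and
zero on it, and [Lp_tail] takes care of [F N].  *)
Lemma Lpof_density (S : set LP) :
  S 0 -> (forall a u v, S u -> S v -> S (a *: u + v)) ->
  (forall B (e : R), measurable B -> 0 < e ->
     exists2 u, S u & nrm (u - Lpof (cut B (cst 1))) < e) ->
  dense S.
Proof.
move=> S0 SD S1; apply/dense_nrmP.
pose S' : set LP := [set v | forall e : R, 0 < e -> exists2 u, S u & nrm (u - v) < e].
have S'0 : S' 0 by move=> e e0; exists 0 => //; rewrite subrr nrm0.
have S'D a u v : S' u -> S' v -> S' (a *: u + v).
  move=> Su Sv e e0.
  have ma : 0 < modulus a + 1 by rewrite ltr_wpDl// modulus_ge0.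
  have e20 : 0 < e / 2 by rewrite divr_gt0.
  have [u' Su' uu'] := Su (e / 2 / (modulus a + 1)) (divr_gt0 e20 ma).
  have [v' Sv' vv'] := Sv _ e20.
  exists (a *: u' + v'); first exact: SD.
  rewrite opprD addrACA -scalerBr (le_lt_trans (ler_nrmD _ _))// nrmZ.
  rewrite [ltRHS]splitr ler_ltD//.
  apply: le_trans (_ : (modulus a + 1) * nrm (u' - u) <= _).
    by rewrite ler_wpM2r ?nrm_ge0// lerDl.
  by rewrite mulrC -ler_pdivlMr// ltW.
move=> u e e0.
have [g gL ->] := LpofP u; have mg := Lpfun_measurable gL.
have e40 : 0 < e / 4 by rewrite divr_gt0.
pose q n : K := rat_point R k (odflt (0, 0) (unpickle n)).
pose B n := [set x | modulus (g x - q n) < e / 4].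
have mB n : measurable (B n).
  have /measurable_scalarsP := mg.
  move=> /(_ _ (@open_modulus_ball R k (q n) (e / 4))); congr measurable.
  by apply/seteqP; split => x /=; rewrite -modulusN opprB.
(* F N is the set where none of the first N scalars is close to g *)
pose F N := [set x | forall n, (n < N)%N -> ~ B n x].
have FS N : F N.+1 = F N `\` B N.
  apply/seteqP; split => x /= => [Fx|[Fx Bx] n].
    by split => [n nN|]; apply: Fx => //; rewrite ltnS ltnW.
  by rewrite ltnS leq_eqVlt => /orP[/eqP ->//|]; exact: Fx.
have mF N : measurable (F N).
  elim: N => [|N IH]; last by rewrite FS; exact: measurableD.
  by rewrite (_ : F 0%N = setT)//; apply/seteqP; split.
have sL N : exists s : T -> K, [/\ s \in Lpfun mu p1, S' (Lpof s),
    forall x, F N x -> s x = 0 & forall x, ~ F N x -> modulus (s x - g x) < e / 4].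
  elim: N => [|N [s [sL Ss s0 sg]]].
    exists 0; split => //; [exact: rpred0|by rewrite Lpof0|].
    by move=> x []; move=> n.
  have mFB : measurable (F N `&` B N) by exact: measurableI.
  have cL : cut (F N `&` B N) (cst 1) \in Lpfun mu p1.
    apply: cut_Lpfun => //; apply: (@bounded_Lpfun _ (modulus (1 : K))) => //.
  exists (q N *: cut (F N `&` B N) (cst 1) + s); split.
  - by rewrite rpredD// rpredZ.
  - rewrite LpofD//; apply: S'D => //.
    by move=> r r0; exact: S1.
  - rewrite FS => x [Fx Bx].
    rewrite -[LHS]/(q N * cut (F N `&` B N) (cst 1) x + s x) s0// cut_out//.
      by rewrite mulr0 addr0.
    by case.
  move=> x; rewrite FS => FBx.
  rewrite -[X in modulus (X - _)]/(q N * cut (F N `&` B N) (cst 1) x + s x).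
  have [Fx|Fx] := pselect (F N x); last first.
    by rewrite cut_out ?mulr0 ?add0r ?sg//; case.
  have Bx : B N x by apply: contrapT => Bx; apply: FBx.
  by rewrite cut_in//= mulr1 s0// addr0 -modulusN opprB.
have [|N FN] := @Lp_tail g F (e / 4) gL mF _ e40.
  move=> x; have [t /= xt] := rat_point_dense (g x) e40.
  exists (pickle t).+1 => n tn /(_ (pickle t) tn); apply.
  by rewrite -[B _ x]/(is_true (modulus (g x - q (pickle t)) < e / 4)) /q pickleK.
have [s [sL' Ss s0 sg]] := sL N.
have e20 : 0 < e / 2 by rewrite divr_gt0.
have [v Sv vs] := Ss _ e20; exists v => //.
apply: le_lt_trans (ler_nrm_triangle v (Lpof s) (Lpof g)) _.
rewrite [ltRHS]splitr ltr_leD//.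
have cL := cut_Lpfun (mF N) gL.
rewrite -LpofB//.
have mFC : measurable (~` F N) by exact: measurableC.
have sgL : s - g \in Lpfun mu p1 by rewrite rpredB.
have dL := cut_Lpfun mFC sgL.
have -> : s - g = cut (~` F N) (s - g) - cut (F N) g.
  apply/funext => x; rewrite -[RHS]/(cut (~` F N) (s - g) x - cut (F N) g x).
  have [Fx|Fx] := pselect (F N x).
    by rewrite cut_out ?cut_in// -[LHS]/(s x - g x) s0.
  by rewrite cut_in ?(cut_out _ Fx)// subr0.
rewrite LpofB// (le_trans (ler_nrmD _ _))// nrmN.
rewrite (_ : e / 2 = e / 4 + e / 4); last by lra.
rewrite lerD ?(ltW FN)//.
apply: nrm_bounded; first exact: Lpfun_measurable dL.
move=> x; have [Fx|Fx] := pselect (F N x).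
  by rewrite cut_out// modulus0 ltW.
by rewrite cut_in// -[s - g]/(fun x => s x - g x) ltW// sg.
Qed.

Lemma limn_einf_le (u : nat -> \bar R) (c : \bar R) N :
  (forall n, (N <= n)%N -> (u n <= c)%E) -> (limn_einf u <= c)%E.
Proof.
move=> uc; rewrite limn_einf_lim; apply: lime_le; first exact: is_cvg_einfs.
exists N => // n /= Nn; apply: le_trans (uc n Nn).
by apply: ereal_inf_lbound; exists n => //=.
Qed.

Lemma sum_half_le n : \sum_(0 <= i < n) 2^-1 ^+ i <= (2 : R).
Proof.
suff -> : \sum_(0 <= i < n) 2^-1 ^+ i = 2 - 2 * 2^-1 ^+ n :> R.
  by rewrite gerBl mulr_ge0// exprn_ge0.
elim: n => [|n IH]; first by rewrite big_nil expr0 mulr1 subrr.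
by rewrite big_nat_recr//= IH exprS; field.
Qed.

(** By Borel-Cantelli almost every point lies in finitely many [E n], so the
sequence is eventually constant there; the limit is measurable as a countable
gluing of the [g n], and Fatou's lemma transfers the norm estimates.  *)
Lemma stationary_limit (g : nat -> T -> K) (E : nat -> set T) (r : nat -> R) :
  (forall n, g n \in Lpfun mu p1) -> (forall n, measurable (E n)) ->
  (forall n, (mu (E n) <= (2^-1 ^+ n)%:E)%E) ->
  (forall n x, ~ E n x -> g n.+1 x = g n x) ->
  (forall n, 0 <= r n) ->
  (forall i j, (i <= j)%N -> nrm (Lpof (g j - g i)) <= r i) ->
  exists2 h, h \in Lpfun mu p1 & forall i, nrm (Lpof (h - g i)) <= r i.
Proof.
move=> gL mE muE gE r0 gr.
have mg n := Lpfun_measurable (gL n).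
pose W N := ~` \bigcup_(n in [set n | (N <= n)%N]) E n.
have WP N x : W N x -> forall n, (N <= n)%N -> ~ E n x.
  by move=> Wx n Nn Ex; apply: Wx; exists n.
have mW N : measurable (W N).
  by apply: measurableC; apply: bigcup_measurable => n _; exact: mE.
have Wg N x : W N x -> forall n, (N <= n)%N -> g n x = g N x.
  move=> Wx n /subnKC <-; elim: (n - N)%N => [|m IH]; first by rewrite addn0.
  by rewrite addnS gE// ; apply: (WP N) => //; exact: leq_addr.
have Wgg N M x : W N x -> W M x -> g N x = g M x.
  move=> WN WM; rewrite -(Wg _ _ WN (maxn N M)) ?leq_maxl//.
  by rewrite (Wg _ _ WM) ?leq_maxr.
have limE0 : mu (lim_sup_set E) = 0%E.
  apply: lim_sup_set_cvg0 => //; apply: le_lt_trans (ltry 2).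
  apply: lime_le; first exact: is_cvg_nneseries.
  apply: nearW => n; apply: le_trans (_ : (\sum_(0 <= i < n) 2^-1 ^+ i)%:E <= _)%E.
    by rewrite -sumEFin; apply: lee_sum => i _; exact: muE.
  by rewrite lee_fin sum_half_le.
pose Winf := \bigcup_N W N.
have mWinf : measurable Winf by exact: bigcup_measurable.
have muW : {ae mu, forall x, Winf x}.
  exists (lim_sup_set E); split => //.
    by apply: bigcap_measurable => // n _; apply: bigcup_measurable.
  move=> x /= Wx N _; apply: contrapT => xN; apply: Wx; exists N => //.
pose h x := if pselect (exists N, W N x) is left e then g (projT1 (cid e)) x else 0.
have hW N x : W N x -> h x = g N x.
  move=> WN; rewrite /h; case: pselect => [e|[]]; last by exists N.
  by apply: Wgg => //; exact: (projT2 (cid e)).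
have hWinf x : ~ Winf x -> h x = 0.
  move=> Wx; rewrite /h; case: pselect => // -[N WN].
  by exfalso; apply: Wx; exists N.
have mh : measurableK h.
  apply/measurable_scalarsP => U oU.
  rewrite (_ : h @^-1` U = \bigcup_N (W N `&` g N @^-1` U) `|`
     (~` Winf `&` [set _ | U 0])); last first.
    apply/seteqP; split => x /=.
      have [[N _ WN]|nW] := pselect (Winf x).
        by rewrite (hW N)//; left; exists N.
      by rewrite hWinf//; right.
    by move=> [[N _ [WN]]|[nW]]; [rewrite /= (hW N)|rewrite hWinf].
  apply: measurableU.
    apply: bigcup_measurable => N _; apply: measurableI => //.
    by have /measurable_scalarsP := mg N; apply.
  apply: measurableI; first exact: measurableC.
  have [U0|U0] := pselect (U 0).
    by rewrite (_ : [set _ | _] = setT)//; apply/seteqP; split.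
  by rewrite (_ : [set _ | _] = set0)//; apply/seteqP; split.
have mB (f f' : T -> K) : measurableK f -> measurableK f' -> measurableK (f - f').
  move=> mf mf'; apply: (measurable_op2 (h := fun x y => x - y)) => //.
  by move=> z; exact: sub_continuous.
have hi i : (pint (h - g i) <= (r i `^ p)%:E)%E.
  pose f n x := (modulus (g n x - g i x) `^ p)%:E.
  have mf n : measurable_fun setT (f n) by exact/measurable_pint/mB.
  have f0 n x : [set: T] x -> (0 <= f n x)%E by rewrite lee_fin powR_ge0.
  have := fatou mu measurableT mf f0.
  rewrite (ae_eq_integral (fun x => (modulus ((h - g i) x) `^ p)%:E)) //.
  - move/le_trans; apply; apply: (@limn_einf_le _ _ i) => n ni.
    by rewrite -(@nrm_le (g n - g i)) ?gr// rpredB.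
  - rewrite /limn_einf; apply: measurableT_comp => //.
    apply: (measurable_fun_limn_esup (f := fun n x => (- f n x)%E)) => n.
    exact: measurableT_comp.
  - exact/measurable_pint/mB.
  apply: filterS muW => x [N _ WN] _.
  suff : f ^~ x @ \oo --> (modulus ((h - g i) x) `^ p)%:E.
    move=> /[dup] /cvg_lim <-// ?; apply: is_cvg_limn_einfE.
    by apply/cvg_ex; eexists; eassumption.
  apply: cvg_near_cst; exists N => // n /= Nn.
  by rewrite /f (Wg N)// -(hW N).
have hgL i : h - g i \in Lpfun mu p1.
  by apply: LpfunE; [exact: mB|rewrite (le_lt_trans (hi i))// ltry].
exists h; first by rewrite -(subrK (g 0%N) h) rpredD.
by move=> i; rewrite nrm_le.
Qed.

(** A Baire category argument made explicit.  Targets [v i] with precisions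
[1 / (t + 1)] are enumerated as a sequence; at each step the current function
is modified slightly, and on a small set, so that some iterate hits the next
target.  Continuity then provides a radius within which all later corrections
must stay, and the limit of the sequence inherits every hit.  The set [Q]
restricts the functions that have to be corrected, for instance to bounded
ones. *)
Lemma hypercyclic_of_transitive (I : countType) (v : I -> LP) (Tf : LP -> LP)
    (Q : set (T -> K)) :
  dense (range v) -> continuous Tf -> (forall g, Q g -> g \in Lpfun mu p1) ->
  Q !=set0 ->
  (forall (u : T -> K) i (e : R), Q u -> 0 < e ->
    exists w n E, [/\ Q w, (1 <= n)%N, measurable E /\ (mu E < e%:E)%E,
      forall x, ~ E x -> w x = u x &
      nrm (Lpof (w - u)) < e /\ nrm (iter n Tf (Lpof w) - v i) < e]) ->
  hypercyclic Tf.
Proof.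
move=> dv cT QL [g0 Qg0] trans.
have /dense_nrmP/(_ 0 1 ltr01)[_ [i0 _ _] _] := dv.
pose dec s := odflt (i0, 0%N) (unpickle s : option (I * nat)).
pose prec s : R := (dec s).2.+1%:R^-1.
have prec0 s : 0 < prec s by rewrite invr_gt0.
(* a state is a function u with a radius r: later functions must stay within
   distance r of u, and halving r at each step keeps the corrections summable *)
pose good (z : nat * ((T -> K) * R)) (z' : (T -> K) * R) :=
  let: (s, (u, r)) := z in let: (w, r') := z' in
  [/\ Q w, 0 < r', r' <= r / 2, nrm (Lpof (w - u)) <= r / 2 &
   (exists E, [/\ measurable E, (mu E <= (2^-1 ^+ s)%:E)%E &
     forall x, ~ E x -> w x = u x]) /\
   exists2 n, (1 <= n)%N & forall y, nrm (y - Lpof w) <= r' ->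
     nrm (iter n Tf y - v (dec s).1) < prec s].
have step (z : nat * ((T -> K) * R)) : exists z', Q z.2.1 /\ 0 < z.2.2 -> good z z'.
  case: z => s [u r] /=; have [[Qu r0]|//] := pselect (Q u /\ 0 < r); last first.
    by move=> h; exists (u, r) => /h.
  pose e := Num.min (r / 2) (Num.min (2^-1 ^+ s) (prec s / 2)).
  have e0 : 0 < e by rewrite !lt_min !divr_gt0 ?exprn_gt0.
  have er : e <= r / 2 by rewrite ge_min lexx.
  have es : e <= 2^-1 ^+ s by rewrite !ge_min lexx orbT.
  have ep : e <= prec s / 2 by rewrite !ge_min lexx !orbT.
  have [w [n [E [Qw n1 [mE muE] wu [wu' wv]]]]] := trans u (dec s).1 e Qu e0.
  have /continuous_nrmP cTn := continuous_iter (n := n) cT.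
  have ps0 : 0 < prec s / 2 by rewrite divr_gt0.
  have [rho rho0 hrho] := cTn (Lpof w) _ ps0.
  exists (w, Num.min (r / 2) (rho / 2)) => _; split => //.
  - by rewrite lt_min !divr_gt0.
  - by rewrite ge_min lexx.
  - exact: le_trans (ltW wu') er.
  split.
    by exists E; split => //; rewrite (le_trans (ltW muE))// lee_fin.
  exists n => // y yw.
  apply: le_lt_trans (ler_nrm_triangle _ (iter n Tf (Lpof w)) _) _.
  rewrite [ltRHS]splitr ltr_leD//; last exact: le_trans (ltW wv) ep.
  apply: hrho; apply: le_lt_trans yw _.
  by rewrite gt_min; apply/orP; right; rewrite ltr_pdivrMr// ltr_pMr// ltr1n.
have [F FP] := choice step.
pose S := fix S n := if n is n'.+1 then F (n', S n') else (g0, 1 : R).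
have SP n : Q (S n).1 /\ 0 < (S n).2.
  elim: n => [//|n IH]; have := FP (n, S n) IH.
  by rewrite /good -/(S n.+1); case: (S n) => u r; case: (S n.+1) => w r' [].
pose u n := (S n).1; pose r n := (S n).2.
have Sgood n : good (n, (u n, r n)) (u n.+1, r n.+1).
  have := FP (n, S n) (SP n); rewrite -/(S n.+1) /u /r.
  by case: (S n) => ? ?; case: (S n.+1).
have Qu n : Q (u n) by have [] := SP n.
have r_gt0 n : 0 < r n by have [] := SP n.
have uL n : u n \in Lpfun mu p1 by exact: QL.
have r2 n : r n.+1 <= r n / 2 by have [] := Sgood n.
have uu n : nrm (Lpof (u n.+1 - u n)) <= r n / 2 by have [] := Sgood n.
have /choice[E EP] n : exists E, [/\ measurable E, (mu E <= (2^-1 ^+ n)%:E)%E &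
     forall x, ~ E x -> u n.+1 x = u n x] by have [_ _ _ _ []] := Sgood n.
have uij i j : (i <= j)%N -> nrm (Lpof (u j - u i)) <= r i.
  move=> /subnKC <-; move: (j - i)%N => m.
  (* the distance still allowed decreases at least as fast as it is used up *)
  suff : nrm (Lpof (u (i + m)%N - u i)) <= r i - r (i + m)%N.
    by move/le_trans; apply; rewrite gerBl ltW.
  elim: m => [|m IH]; first by rewrite addn0 !subrr Lpof0 nrm0.
  rewrite addnS LpofB//.
  apply: le_trans (ler_nrm_triangle _ (Lpof (u (i + m)%N)) _) _.
  rewrite -!LpofB//; have := uu (i + m)%N; have := r2 (i + m)%N; lra.
have [h hL hu] := @stationary_limit u E r uL (fun n => let: And3 m _ _ := EP n in m)
  (fun n => let: And3 _ m _ := EP n in m) (fun n => let: And3 _ _ m := EP n in m)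
  (fun n => ltW (r_gt0 n)) uij.
exists (Lpof h); apply/dense_nrmP => y e e0.
have e20 : 0 < e / 2 by rewrite divr_gt0.
have /dense_nrmP/(_ y _ e20)[_ [i _ <-] vy] := dv.
have [t _ /(_ t (leqnn t))/= te] := near_infty_natSinv_lt (PosNum e20).
have [_ _ _ _ [_ [n n1 hn]]] := Sgood (pickle (i, t)).
exists (iter n Tf (Lpof h)); first by exists n.
apply: le_lt_trans (ler_nrm_triangle _ (v i) _) _.
rewrite [ltRHS]splitr ltrD//.
have : nrm (Lpof h - Lpof (u (pickle (i, t)).+1)) <= r (pickle (i, t)).+1.
  by rewrite -LpofB.
move=> /hn; rewrite /prec /dec pickleK /= => /lt_trans; exact.
Qed.

End Lp_tools.

(** * Notions of chaos in a normed space *)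

Section limn_einf_esup.
Context (R : realType).
Implicit Types u : nat -> R.

Lemma limn_einf_eq0P u : (forall n, 0 <= u n) ->
  limn_einf (fun n => (u n)%:E) = 0%E <->
  forall (e : R) N, 0 < e -> exists2 n, (N <= n)%N & u n < e.
Proof.
move=> u0; rewrite limn_einf_lim; split=> [lim0 e N e0|hu].
  apply: contrapT => ne.
  have : (e%:E <= 0 :> \bar R)%E; last by rewrite lee_fin leNgt e0.
  rewrite -lim0; apply: lime_ge; first exact: is_cvg_einfs.
  exists N => // n /= Nn; apply: le_ereal_inf_tmp => _ [m /= nm <-].
  rewrite lee_fin leNgt; apply/negP => um; apply: ne; exists m => //.
  exact: leq_trans Nn nm.
rewrite (_ : einfs _ = cst 0%E) ?lim_cst//; apply/funext => n.
apply/eqP; rewrite eq_le; apply/andP; split.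
  apply/lee_addgt0Pr => e e0; rewrite add0e.
  have [m nm um] := hu e n e0.
  apply: le_trans (ereal_inf_lbound _) _; first by exists m.
  by rewrite lee_fin ltW.
by apply: le_ereal_inf_tmp => _ [m _ <-]; rewrite lee_fin.
Qed.

Lemma limn_esup_eqyP u :
  limn_esup (fun n => (u n)%:E) = +oo%E <->
  forall (M : R) N, exists2 n, (N <= n)%N & M < u n.
Proof.
rewrite limn_esup_lim; split=> [limy M N|hu].
  apply: contrapT => ne.
  suff : (+oo <= M%:E :> \bar R)%E by rewrite leye_eq.
  rewrite -limy; apply: lime_le; first exact: is_cvg_esups.
  exists N => // n /= Nn; apply: ge_ereal_sup => _ [m /= nm <-].
  rewrite lee_fin leNgt; apply/negP => um; apply: ne; exists m => //.
  exact: leq_trans Nn nm.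
rewrite (_ : esups _ = cst +oo%E) ?lim_cst//; apply/funext => n.
apply: eq_infty => M; have [m nm um] := hu M n.
apply: (@le_trans _ _ (u m)%:E); first by rewrite lee_fin ltW.
by apply: ereal_sup_ubound; exists m.
Qed.

End limn_einf_esup.

Section chaos.
Context (R : realType) (k : base_field) (V : normedModType (scalars R k)).
Context (T : {linear V -> V}).

Lemma iter_linear0 n : iter n T 0 = 0.
Proof. by elim: n => //= n ->; rewrite linear0. Qed.

Lemma hypercyclic_supercyclic : hypercyclic T -> supercyclic T.
Proof.
move=> [x dx]; exists x => U U0 oU; have [y [Uy [n n1 ny]]] := dx U U0 oU.
by exists y; split => //; exists 1, n; rewrite scale1r ny.
Qed.

(** A dense orbit is unbounded and comes arbitrarily close to 0.  Both happen at
arbitrarily late times: aiming beyond the maximum, or below the minimum, of the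
first [N] orbit norms excludes the first [N] iterates.  That minimum is positive,
for an orbit which reaches 0 stays there and is bounded. *)
Lemma hypercyclic_Li_Yorke (v : V) : v != 0 -> hypercyclic T -> Li_Yorke_chaotic T.
Proof.
move=> v0 [x /dense_nrmP dx].
pose u n := nrm (iter n T x).
have nv0 : 0 < nrm v.
  rewrite lt_neqAle nrm_ge0 andbT eq_sym; apply: contra_neq v0; exact: nrm_eq0.
have bnd N : exists M : R, forall n, (n < N)%N -> u n <= M.
  elim: N => [|N [M hM]]; first by exists 0.
  exists (Num.max M (u N)) => n; rewrite ltnS leq_eqVlt le_max.
  by move=> /orP[/eqP ->|/hM ->//]; rewrite lexx orbT.
have hsup (M : R) N : exists2 n, (N <= n)%N & M < u n.
  have [M' hM'] := bnd N; pose B := Num.max 0 (Num.max M M').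
  have [B0 BM BM'] : [/\ 0 <= B, M <= B & M' <= B].
    by rewrite !le_max !lexx !orbT.
  pose c := (B + 2) / nrm v.
  have [_ [n n1 <-] nc] := dx (of_real k c *: v) 1 ltr01.
  have un : B < u n.
    have := ler_nrm_triangle (of_real k c *: v) (iter n T x) 0.
    rewrite !subr0 nrmB -/(u n) nrmZ.
    rewrite (_ : modulus (of_real k c) = c); last first.
      apply: (@of_real_inj R k); rewrite of_real_modulus.
      rewrite -[RHS]ger0_norm// -(@of_real0 R k) ler_of_real.
      by rewrite divr_ge0 ?nrm_ge0// addr_ge0.
    rewrite /c divfK ?gt_eqF//; lra.
  exists n; last exact: le_lt_trans un.
  rewrite leqNgt; apply/negP => /hM'; rewrite leNgt => /negP; apply.
  exact: le_lt_trans un.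
have upos n : 0 < u n.
  rewrite lt_neqAle nrm_ge0 andbT eq_sym; apply/eqP => /nrm_eq0 Tn0.
  have [m nm] := hsup 0 n; rewrite /u -(subnK nm) iterD Tn0 iter_linear0 nrm0.
  by rewrite ltxx.
have lbnd N : exists2 M : R, 0 < M & forall n, (n < N)%N -> M <= u n.
  elim: N => [|N [M M0 hM]]; first by exists 1.
  exists (Num.min M (u N)) => [|n]; first by rewrite lt_min M0 upos.
  rewrite ltnS leq_eqVlt ge_min.
  by move=> /orP[/eqP ->|/hM ->//]; rewrite lexx orbT.
have hinf (e : R) N : 0 < e -> exists2 n, (N <= n)%N & u n < e.
  move=> e0; have [M M0 hM] := lbnd N.
  have [|_ [n n1 <-]] := dx 0 (Num.min M e); first by rewrite lt_min M0.
  rewrite subr0 lt_min -/(u n) => /andP[uM ue]; exists n => //.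
  by rewrite leqNgt; apply/negP => /hM; rewrite leNgt uM.
exists x; split.
  by apply/limn_einf_eq0P => // n; exact: nrm_ge0.
by apply/limn_esup_eqyP.
Qed.

Lemma Li_Yorke_orbit : Li_Yorke_chaotic T ->
  exists2 x : V, x <> 0 & forall e : R, 0 < e -> exists n, nrm (iter n T x) < e.
Proof.
move=> [x [/limn_einf_eq0P inf0 /limn_esup_eqyP supy]]; exists x.
  move=> x0; have [n _] := supy 0 0%N.
  by rewrite x0 iter_linear0 -/(nrm _) nrm0 ltxx.
by move=> e e0; have [|n _ hn] := inf0 _ e 0%N e0; [move=> n; exact: nrm_ge0|exists n].
Qed.

End chaos.

(** * The odometer as a counter *)

Section counter.
Context (alpha : nat -> nat) (alpha_ge2 : forall n, (2 <= alpha n)%N).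
Local Notation X := (odometer_space alpha_ge2).
Local Notation f := (odometer alpha_ge2).
Implicit Types (x y : X).

Fixpoint carry x i : bool :=
  if i is j.+1 then carry x j && ((x j : nat) == (alpha j).-1) else true.

Lemma carryP x i :
  reflect (forall j, (j < i)%N -> (x j : nat) = (alpha j).-1) (carry x i).
Proof.
elim: i => [|i IH] /=; first by constructor.
apply: (iffP andP) => [[/IH h /eqP xi] j|h].
  by rewrite ltnS leq_eqVlt => /orP[/eqP ->//|]; exact: h.
by split; [apply/IH => j ji; apply: h; exact: ltnW|apply/eqP; exact: h].
Qed.

Lemma digit_lt x i : (x i < alpha i)%N.
Proof. exact: ltn_ord. Qed.

(** Digit by digit description: a digit is incremented modulo its base exactly
when a carry reaches it. *)
Lemma odometerE x i :
  (f x i : nat) = if carry x i then ((x i).+1 %% alpha i)%N else x i.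
Proof.
have a0 : (0 < alpha i)%N by exact: ltnW.
rewrite /odometer; case: pselect => [nonmax|allmax]; last first.
  have xmax j : (x j : nat) = (alpha j).-1.
    by apply/eqP/negPn/negP => xj; apply: allmax; exists j.
  have -> : carry x i by apply/carryP => j _; exact: xmax.
  by rewrite xmax prednK// modnn.
case: ex_minnP => l xl lmin.
have cl : carry x l.
  apply/carryP => j jl; apply/eqP/negPn/negP => /lmin.
  by rewrite leqNgt jl.
case: (ltngtP i l) => [il|li|->].
- have -> : carry x i by apply/carryP => j ji; apply: (carryP _ _ cl); exact: ltn_trans il.
  by rewrite (carryP _ _ cl)// prednK// modnn.
- by case: carryP => // /(_ _ li) /eqP; rewrite (negbTE xl).
have xl1 : ((x l).+1 < alpha l)%N.
  by have := digit_lt x l; move: xl (alpha_ge2 l); lia.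
by rewrite cl modn_small// val_insubd xl1.
Qed.

Definition period m : nat := \prod_(i < m) alpha i.

Lemma periodS m : period m.+1 = (period m * alpha m)%N.
Proof. by rewrite /period big_ord_recr. Qed.

Lemma period_gt0 m : (0 < period m)%N.
Proof. by apply: prodn_gt0 => i; exact: ltnW. Qed.

(** The number written by the first [m] digits in mixed radix.  It identifies a
cylinder of depth [m], and the odometer increments it modulo [period m]. *)
Definition counter m x : nat := \sum_(i < m) x i * period i.

Lemma counterS m x : counter m.+1 x = (counter m x + x m * period m)%N.
Proof. by rewrite /counter big_ord_recr. Qed.

Lemma counter_lt m x : (counter m x < period m)%N.
Proof.
elim: m => [|m IH]; first by rewrite /counter /period !big_ord0.
rewrite counterS periodS.
have := digit_lt x m; move: IH; nia.
Qed.

Definition agree m x y := forall i, (i < m)%N -> x i = y i.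

Lemma agree_sym m x y : agree m x y -> agree m y x.
Proof. by move=> xy i /xy. Qed.

Lemma agree_le m n x y : (m <= n)%N -> agree n x y -> agree m x y.
Proof. by move=> mn xy i im; apply: xy; exact: leq_trans mn. Qed.

Lemma counterP m x y : counter m x = counter m y <-> agree m x y.
Proof.
split; last first.
  by move=> xy; apply: eq_bigr => i _; rewrite xy.
elim: m => [_ i|m IH]; first by rewrite ltn0.
rewrite !counterS => e.
have xy : (x m : nat) = y m.
  have hx := counter_lt m x; have hy := counter_lt m y.
  have := congr1 (fun z => z %/ period m)%N e.
  by rewrite ![(counter m _ + _)%N]addnC !divnMDl ?period_gt0// !divn_small// !addn0.
have cxy : counter m x = counter m y by move: e; rewrite xy => /addIn.
move=> i; rewrite ltnS leq_eqVlt => /orP[/eqP ->|]; last exact: IH.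
exact: val_inj.
Qed.

(** The invariant of addition with carry, from which the action on the counter
and the invariance of the remaining digits both follow. *)
Lemma counter_carry m x :
  (counter m (f x) + carry x m * period m = (counter m x).+1)%N.
Proof.
elim: m => [|m IH]; first by rewrite /counter /period !big_ord0.
rewrite !counterS periodS odometerE /=.
case: (carry x m) IH => /= IH; last by rewrite mul0n; lia.
have := alpha_ge2 m; have := digit_lt x m; case: eqP => xm ltx a2.
  rewrite xm prednK ?(ltnW a2)// modnn.
  have : (alpha m = (alpha m).-1 + 1)%N by lia.
  move: IH; nia.
rewrite modn_small; last by lia.
move: IH; nia.
Qed.

Lemma counter_odometer m x : counter m (f x) = ((counter m x).+1 %% period m)%N.
Proof.
have := counter_carry m x; have := counter_lt m x; have := counter_lt m (f x).
case: (carry x m) => h1 h2 e.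
  have -> : (counter m x).+1 = period m by lia.
  by rewrite modnn; lia.
by rewrite modn_small; lia.
Qed.

Lemma counter_iter m n x :
  counter m (iter n f x) = ((counter m x + n) %% period m)%N.
Proof.
elim: n => [|n IH]; first by rewrite addn0 modn_small// counter_lt.
by rewrite iterS counter_odometer IH -addn1 modnDml -addnA addn1.
Qed.

(** As long as the counter does not wrap around, no carry leaves the first [m]
digits. *)
Lemma iter_tail m n x : (counter m x + n < period m)%N ->
  forall i, (m <= i)%N -> iter n f x i = x i.
Proof.
move=> + i mi; elim: n => [//|n IH] h; rewrite iterS.
have <- := IH (leq_ltn_trans (leq_add (leqnn _) (leqnSn _)) h).
apply: val_inj; rewrite /= [LHS]odometerE.
case: carryP => // hc.
have cm : carry (iter n f x) m by apply/carryP => j jm; apply: hc; exact: leq_trans mi.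
have := counter_carry m (iter n f x); rewrite cm counter_iter modn_small; last by lia.
by lia.
Qed.

Lemma iter_period_agree m k x : agree m x (iter (k * period m) f x).
Proof.
apply/counterP; rewrite counter_iter addnC modnMDl modn_small//.
exact: counter_lt.
Qed.

End counter.

(** * Cylinders and sets of finite level *)

Section cylinders.
Context (alpha : nat -> nat) (alpha_ge2 : forall n, (2 <= alpha n)%N).
Local Notation X := (odometer_space alpha_ge2).
Local Notation DS := (digit_sequences alpha_ge2).
Implicit Types (x y : X) (D B : set X).

Definition cylinder m x : set X := [set y | agree m x y].

Lemma nbhs_cylinder m x : nbhs (x : DS) (cylinder m x).
Proof.
elim: m => [|m IH].
  by rewrite (_ : cylinder 0 x = setT); [exact: filterT|apply/seteqP; split].
have xm : nbhs (x : DS) [set y : DS | y m = x m].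
  have := @proj_continuous nat (fun n => discrete_topology (digit alpha_ge2 n)) m x.
  by move=> /(_ [set x m]); apply; exact: discrete_set1.
apply: filterS2 IH xm => y xy ymx i; rewrite ltnS leq_eqVlt.
by move=> /orP[/eqP ->//|]; exact: xy.
Qed.

(** Cylinders around [x] converge to [x] because every coordinate is eventually
fixed on them, and the product topology is the coarsest one with this
property. *)
Lemma nbhs_cylinderP x (U : set DS) :
  nbhs (x : DS) U <-> exists m, cylinder m x `<=` U.
Proof.
split=> [|[m mU]]; last exact: filterS mU (nbhs_cylinder m x).
pose F : set_system DS := [set U | exists m, cylinder m x `<=` U].
have FF : Filter F.
  split; first by exists 0%N.
  - move=> P Q [m mP] [n nQ]; exists (maxn m n) => y xy; split.
      by apply: mP; apply: agree_le xy; exact: leq_maxl.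
    by apply: nQ; apply: agree_le xy; exact: leq_maxr.
  - by move=> P Q PQ [m mP]; exists m; exact: subset_trans PQ.
suff : F --> (x : DS) by move/(_ U).
apply/cvg_sup => i; apply/cvg_image.
  apply/seteqP; split => // a _; exists (dfwith (x : DS) i a) => //.
  by rewrite dfwithin.
move=> V /nbhs_singleton Vx; exists [set y : DS | V (y i)].
  by exists i.+1 => y /= xy; rewrite -xy.
apply/seteqP; split => [_ [y Vy <-]//|a Va].
by exists (dfwith (x : DS) i a); rewrite /= dfwithin.
Qed.

Definition finite_level D := exists m, forall x y, agree m x y -> D x -> D y.

Lemma cylinder_level m x : finite_level (cylinder m x).
Proof.
by exists m => y z yz xy i im; rewrite (xy _ im) (yz _ im).
Qed.

Lemma finite_level_open D : finite_level D -> open (D : set DS).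
Proof.
move=> [m mD]; rewrite openE => x Dx; apply/nbhs_cylinderP; exists m => y xy.
exact: mD xy Dx.
Qed.

Lemma finite_level_measurable D : finite_level D -> measurable D.
Proof. by move=> /finite_level_open; exact: sub_sigma_algebra. Qed.

Lemma cylinder_measurable m x : measurable (cylinder m x).
Proof. by apply: finite_level_measurable; exact: cylinder_level. Qed.

Lemma finite_levelC D : finite_level D -> finite_level (~` D).
Proof.
by move=> [m mD]; exists m => x y xy Dx Dy; apply: Dx; apply: mD Dy; exact: agree_sym.
Qed.

Lemma finite_levelU D B :
  finite_level D -> finite_level B -> finite_level (D `|` B).
Proof.
move=> [m mD] [n nB]; exists (maxn m n) => x y xy [Dx|Bx].
  by left; apply: mD Dx; apply: agree_le xy; exact: leq_maxl.
by right; apply: nB Bx; apply: agree_le xy; exact: leq_maxr.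
Qed.

(** The level [n] part of an open set consists of the points whose cylinder of
depth [n] it contains; these parts increase with [n]. *)
Lemma open_bigcup_level (U : set DS) : open U ->
  exists2 D : nat -> set X, (forall n, finite_level (D n)) /\ nondecreasing_seq D &
    U = \bigcup_n D n.
Proof.
move=> oU; exists (fun n => [set x | cylinder n x `<=` U]).
  split=> [n|i j ij]; last first.
    apply/subsetPset => x /= ixU y jxy; apply: ixU.
    exact: agree_le ij jxy.
  exists n => x y xy /= xU z yz; apply: xU => i ni.
  by rewrite (xy _ ni) (yz _ ni).
apply/seteqP; split => [x Ux|x [n _]]; last by apply.
have /nbhs_cylinderP[m mU] : nbhs x U by exact: open_nbhs_nbhs.
by exists m.
Qed.

End cylinders.

(** * Approximation of measurable sets *)

Section small_sets.
Context d (T : measurableType d) (R : realType) (mu : probability T R).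
Implicit Types (A B C : set T) (e : R).

Lemma mu_lt_half A B C e : measurable A -> measurable B -> measurable C ->
  C `<=` A `|` B -> (mu A < (e / 2)%:E)%E -> (mu B < (e / 2)%:E)%E ->
  (mu C < e%:E)%E.
Proof.
move=> mA mB mC CAB Ae Be.
apply: (@le_lt_trans _ _ (mu (A `|` B))).
  by apply: le_measure; rewrite ?inE//; exact: measurableU.
apply: le_lt_trans (measureU2 _ _ _) _ => //.
by rewrite [e]splitr EFinD; exact: lteD.
Qed.

Lemma mu_sub_lt A B e : measurable A -> measurable B -> A `<=` B ->
  (mu B < e%:E)%E -> (mu A < e%:E)%E.
Proof.
by move=> mA mB AB; apply: le_lt_trans; apply: le_measure; rewrite ?inE.
Qed.

Lemma mu_bigcup_diff (F : nat -> set T) e : (forall n, measurable (F n)) ->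
  nondecreasing_seq F -> 0 < e ->
  exists n, (mu (\bigcup_n F n `\` F n) < e%:E)%E.
Proof.
move=> mF ndF e0; have mU : measurable (\bigcup_n F n) by exact: bigcup_measurable.
have mG n : measurable (\bigcup_n F n `\` F n) by exact: measurableD.
have cap0 : \bigcap_n (\bigcup_n F n `\` F n) = set0.
  apply/seteqP; split => // x xF; have [[n _ Fnx] _] := xF 0%N Logic.I.
  by have [_] := xF n Logic.I; apply.
have cvg0 : mu (\bigcup_n F n `\` F n) @[n --> \oo] --> (0 : \bar R)%E.
  rewrite -(measure0 mu) -cap0; apply: nonincreasing_cvg_mu => //.
  - by rewrite (le_lt_trans (probability_le1 _ _))// ltry.
  - by rewrite cap0.
  - by move=> i j ij; apply/subsetPset; apply: setDS; exact/subsetPset/ndF.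
have ep : (0 < e%:E)%E by rewrite lte_fin.
by have [n _ /(_ n (leqnn n))/= hn] := cvg0 _ (open_ereal_lt' ep); exists n.
Qed.

End small_sets.

Section finite_level_approximation.
Context (R : realType) (alpha : nat -> nat) (alpha_ge2 : forall n, (2 <= alpha n)%N).
Local Notation X := (odometer_space alpha_ge2).
Context (mu : probability X R).
Implicit Types (B D : set X) (e : R).

(** Sets approximable by sets of finite level form a sigma-algebra; closure under
increasing unions also puts the open sets in it. *)
Let approx B := measurable B /\ forall e, 0 < e -> exists2 D, finite_level D &
  (mu (B `\` D) < e%:E)%E /\ (mu (D `\` B) < e%:E)%E.

Let approx_level D : finite_level D -> approx D.
Proof.
move=> lD; split=> [|e e0]; first exact: finite_level_measurable.
by exists D => //; rewrite setDv measure0 lte_fin.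
Qed.

Let approx_nd (F : nat -> set X) : (forall n, approx (F n)) ->
  nondecreasing_seq F -> approx (\bigcup_n F n).
Proof.
move=> aF ndF; have mF n : measurable (F n) by have [] := aF n.
have mU : measurable (\bigcup_n F n) by exact: bigcup_measurable.
split=> // e e0; have e20 : 0 < e / 2 by rewrite divr_gt0.
have [n hn] := mu_bigcup_diff mu mF ndF e20.
have [D lD [FD DF]] := (aF n).2 _ e20; have mD := finite_level_measurable lD.
exists D => //; split.
  apply: mu_lt_half hn FD; rewrite ?setDE; do ?[exact: measurableD].
  move=> x [Ux Dx]; have [Fx|Fx] := pselect (F n x); first by right.
  by left.
have ltee : ((e / 2)%:E < e%:E :> \bar R)%E by rewrite lte_fin ltr_pdivrMr// ltr_pMr// ltr1n.
apply: lt_trans ltee; apply: mu_sub_lt DF; do ?[exact: measurableD].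
by move=> x [Dx Ux]; split => // Fx; apply: Ux; exists n.
Qed.

Let approxC B : approx B -> approx (~` B).
Proof.
move=> [mB aB]; split=> [|e e0]; first exact: measurableC.
have [D lD [BD DB]] := aB e e0; exists (~` D); first exact: finite_levelC.
by rewrite !setDE !setCK setIC -setDE (setIC (~` D)) -setDE.
Qed.

Let approxU B C : approx B -> approx C -> approx (B `|` C).
Proof.
move=> [mB aB] [mC aC]; split=> [|e e0]; first exact: measurableU.
have e20 : 0 < e / 2 by rewrite divr_gt0.
have [D lD [BD DB]] := aB _ e20; have mD := finite_level_measurable lD.
have [E lE [CE EC]] := aC _ e20; have mE := finite_level_measurable lE.
exists (D `|` E); first exact: finite_levelU.
split.
  apply: mu_lt_half BD CE; do ?[exact: measurableD|exact: measurableU|apply: measurableD].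
  by move=> x [[Bx|Cx] DEx]; [left|right]; split => // ?; apply: DEx; [left|right].
apply: mu_lt_half DB EC; do ?[exact: measurableD|exact: measurableU|apply: measurableD].
by move=> x [[Bx|Cx] DEx]; [left|right]; split => // ?; apply: DEx; [left|right].
Qed.

Lemma finite_level_approximation B e : measurable B -> 0 < e ->
  exists2 D, finite_level D & (mu (B `\` D) < e%:E)%E /\ (mu (D `\` B) < e%:E)%E.
Proof.
suff sub : measurable `<=` approx by move=> /sub [_]; exact.
have approx0 : approx set0 by apply: approx_level; exists 0%N.
apply: smallest_sub => [|U /open_bigcup_level[D [lD ndD] ->]]; last first.
  by apply: approx_nd ndD => n; exact: approx_level.
split => // [A aA|F aF]; first by rewrite setTD; exact: approxC.
rewrite -bigcup_bigsetU_bigcup; apply: approx_nd.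
  move=> n; elim: n.+1 => [|j IH]; first by rewrite big_ord0.
  by rewrite big_ord_recr /=; exact: approxU.
apply/nondecreasing_seqP => n.
by apply/subsetPset => x Fx; rewrite big_ord_recr /=; left.
Qed.

End finite_level_approximation.

(** * The product measure *)

Section product_measure.
Context (R : realType) (alpha : nat -> nat) (alpha_ge2 : forall n, (2 <= alpha n)%N).
Local Notation X := (odometer_space alpha_ge2).
Context (m : forall n, probability (digit alpha_ge2 n) R).
Context (mu : probability X R) (mu_prod : is_product_probability m mu).
Implicit Types (x y a : X) (B D : set X) (n k : nat).

Lemma mu_cylinder n a :
  mu (cylinder n a) = (\prod_(i < n) m i [set a i])%E.
Proof.
rewrite -(mu_prod n (fun i => [set a i])); congr (mu _).
by apply/seteqP; split => y ay i im; apply/esym/ay.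
Qed.

(** Projection onto the cylinder of depth [n] around [a], keeping the tail. *)
Definition replace_prefix n a x : X := fun i => if (i < n)%N then a i else x i.

Lemma replace_prefix_agree n k a x y : agree k x y ->
  agree k (replace_prefix n a x) (replace_prefix n a y).
Proof. by move=> xy i ik; rewrite /replace_prefix; case: ifP => // _; exact: xy. Qed.

Lemma measurable_replace_prefix n a : measurable_fun setT (replace_prefix n a).
Proof.
apply: (@measurability _ _ X X setT _ (@open (digit_sequences alpha_ge2))) => //.
move=> _ [_ /open_bigcup_level[D [lD _] ->] <-].
rewrite setTI preimage_bigcup; apply: bigcup_measurable => i _.
apply: finite_level_measurable; have [k kD] := lD i.
by exists k => x y xy; apply: kD; exact: replace_prefix_agree.
Qed.

Lemma mu_replace_prefix_cylinder n a k b :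
  (mu (cylinder n a) * mu (replace_prefix n a @^-1` cylinder k b) =
   mu (cylinder k b `&` cylinder n a))%E.
Proof.
have [ab|ab] := pselect (agree (minn k n) b a); last first.
  rewrite (_ : _ @^-1` _ = set0).
    rewrite (_ : _ `&` _ = set0) ?measure0 ?mule0//.
    apply/seteqP; split => // x [bx ax]; apply: ab => i.
    by rewrite leq_min => /andP[ik im]; rewrite (bx _ ik) (ax _ im).
  apply/seteqP; split => // x bx; apply: ab => i.
  by rewrite leq_min => /andP[ik im]; rewrite (bx _ ik) /replace_prefix im.
have [kn|nk] := leqP k n.
  rewrite (_ : _ @^-1` _ = setT).
    rewrite probability_setT mule1; congr (mu _); apply/esym/setIidPr.
    by move=> x ax i ik; rewrite ab ?(minn_idPl kn)// ax//; exact: leq_trans kn.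
  apply/seteqP; split => // x _ i ik; rewrite /replace_prefix (leq_trans ik kn).
  by rewrite ab// (minn_idPl kn).
have nk' : (n <= k)%N by exact: ltnW.
rewrite (_ : _ @^-1` _ = [set x | forall i, (i < k)%N ->
   (if (i < n)%N then setT else [set b i]) (x i)]); last first.
  apply/seteqP; split => x /= h i ik; have := h i ik; rewrite /replace_prefix.
    by case: ifP => // _ ->.
  by case: ifP => [im _|_ ->//]; rewrite ab// leq_min ik.
rewrite (mu_prod k (fun i => if (i < n)%N then setT else [set b i])).
rewrite (_ : _ `&` _ = cylinder k b); last first.
  apply/setIidPl => x bx i im; have ik := leq_trans im nk'.
  by rewrite -bx// ab// leq_min im ik.
rewrite !mu_cylinder; have bn i : (i < n)%N -> b i = a i.
  by move=> im; apply: ab; rewrite leq_min im (leq_trans im).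
rewrite -(subnKC nk'); elim: (k - n)%N => [|j IH].
  rewrite addn0 [X in (_ * X)%E]big1 ?mule1.
    by apply: eq_bigr => i _; rewrite bn.
  by move=> i _; rewrite ltn_ord probability_setT.
rewrite addnS !big_ord_recr /= muleA IH; congr (_ * _)%E.
by rewrite ltnNge leq_addr.
Qed.

Lemma finite_level_bigcup D : finite_level D -> exists C : nat -> set X,
  [/\ forall j, C j = set0 \/ exists k b, C j = cylinder k b,
      trivIset setT C & D = \bigcup_j C j].
Proof.
move=> [n nD]; pose C j := [set x | D x /\ counter n x = j]; exists C.
split=> [j||]; last 2 first.
- by move=> i j _ _ [x [[_ <-] [_ <-]]].
- by apply/seteqP; split => [x Dx|x [j _ []//]]; exists (counter n x).
have [[x [Dx xj]]|C0] := pselect (exists x, C j x); last first.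
  by left; apply/seteqP; split => // x Cx; apply: C0; exists x.
right; exists n, x; apply/seteqP; split => y.
  by move=> [Dy yj]; apply/counterP; rewrite xj yj.
by move=> xy; split; [exact: nD xy Dx|rewrite -xj; apply/counterP/agree_sym].
Qed.

(** The first [n] digits are independent of the tail: given the cylinder of [a],
the conditional law is the law of [replace_prefix n a].  Both sides are finite
measures in [B] which agree on cylinders, and cylinders together with the empty
set are stable under intersection. *)
Lemma replace_prefix_measure n a B : measurable B ->
  (mu (cylinder n a) * mu (replace_prefix n a @^-1` B) =
   mu (B `&` cylinder n a))%E.
Proof.
move=> mB; have mr := @measurable_replace_prefix n a.
have mc : measurable (cylinder n a) by exact: cylinder_measurable.
pose r : {nonneg R} := NngNum (fine_ge0 (measure_ge0 mu (cylinder n a))).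
have rE : (r%:num)%:E = mu (cylinder n a).
  by rewrite /r /= fineK// fin_num_measure.
pose G : set (set X) := [set C | C = set0 \/ exists k b, C = cylinder k b].
have GP C : G C -> measurable C.
  by move=> [->//|[k [b ->]]]; exact: cylinder_measurable.
have GX : @measurable _ X = <<s G >>.
  apply/seteqP; split; last first.
    apply: smallest_sub; first exact: sigma_algebra_measurable.
    by move=> C; exact: GP.
  apply: smallest_sub; first exact: smallest_sigma_algebra.
  move=> _ /open_bigcup_level[D [lD _] ->]; apply: sigma_algebra_bigcup => i.
  have [C [CG _ ->]] := finite_level_bigcup (lD i).
  by apply: sigma_algebra_bigcup => j; apply: sub_sigma_algebra; exact: CG.
rewrite -rE; apply/esym.
apply: (@measure_unique _ _ X G (fun=> cylinder 0 a) GX _ _ _ (mrestr mu mc)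
  (mscale r (pushforward mu (replace_prefix n a))) _ _ B mB) => //.
- move=> C C' [->|[k [b ->]]]; first by rewrite set0I; left.
  move=> [->|[k' [b' ->]]]; first by rewrite setI0; left.
  have [[x [bx b'x]]|C0] := pselect (exists x, (cylinder k b `&` cylinder k' b') x); last first.
    by left; apply/seteqP; split => // x Cx; apply: C0; exists x.
  right; exists (maxn k k'), x; apply/seteqP; split => y.
    move=> [by_ b'y] i; rewrite leq_max => /orP[] h.
      by rewrite -bx// by_.
    by rewrite -b'x// b'y.
  move=> xy; split=> i h.
    by rewrite bx// xy// leq_max h.
  by rewrite b'x// xy// leq_max h orbT.
- by move=> _; right; exists 0%N, a.
- by apply/seteqP; split => // x _; exists 0%N.
- move=> C [->|[k [b ->]]]; first by rewrite !measure0.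
  by have := mu_replace_prefix_cylinder n a k b; rewrite -rE => /esym.
- move=> _; apply: (@le_lt_trans _ _ 1%E (mu _)); last exact: ltry.
  by apply: probability_le1; apply: measurableI => //; exact: cylinder_measurable.
Qed.

(** A set of finite level is a disjoint union of cylinders. *)
Lemma mu_finite_level_ge (e : R) B D : measurable B ->
  (forall n a, (e%:E * mu (cylinder n a) <= mu (cylinder n a `\` B))%E) ->
  0 <= e -> finite_level D -> (e%:E * mu D <= mu (D `\` B))%E.
Proof.
move=> mB eB e0 lD; have mD := finite_level_measurable lD.
have [C [CG tC DC]] := finite_level_bigcup lD.
have mC j : measurable (C j).
  by have [->//|[k [b ->]]] := CG j; exact: cylinder_measurable.
rewrite {1}DC DC setD_bigcupl !measure_semi_bigcup -?setD_bigcupl -?DC//; last 3 first.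
- by move=> j; exact: measurableD.
- by apply: trivIset_setIr.
- exact: measurableD.
rewrite -nneseriesZl//; apply: lee_nneseries => [j _ _|j _].
  by rewrite mule_ge0.
have [->|[k [b ->]]] := CG j; first by rewrite set0D measure0 mule0.
exact: eB.
Qed.

(** A weak form of Lebesgue's density theorem.  If [B] missed a proportion [e] of
every cylinder, it would miss a proportion [e] of every set of finite level,
including one that approximates [B]. *)
Lemma cylinder_density B (e : R) : measurable B -> (0 < mu B)%E -> 0 < e ->
  exists n a, (mu (cylinder n a `\` B) < e%:E * mu (cylinder n a))%E.
Proof.
move=> mB B0 e0; apply: contrapT => ne.
have eB n a : (e%:E * mu (cylinder n a) <= mu (cylinder n a `\` B))%E.
  by rewrite leNgt; apply/negP => h; apply: ne; exists n, a.
have finmu C : measurable C -> mu C = (fine (mu C))%:E.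
  by move=> mC; rewrite fineK// fin_num_measure.
pose b := fine (mu B).
have b0 : 0 < b by rewrite -lte_fin -finmu.
pose r := e * b / (1 + e) / 2.
have r0 : 0 < r by rewrite !divr_gt0 ?mulr_gt0// addr_gt0.
have [D lD [BD DB]] := finite_level_approximation mu mB r0.
have mD := finite_level_measurable lD.
have := mu_finite_level_ge mB eB (ltW e0) lD.
have : (mu B <= mu D + mu (B `\` D))%E.
  apply: le_trans (measureU2 _ mD (measurableD mB mD)).
  apply: le_measure; rewrite ?inE//; first by apply: measurableU => //; exact: measurableD.
  by move=> x Bx; have [Dx|Dx] := pselect (D x); [left|right].
move: BD DB; rewrite (finmu _ mB) (finmu _ mD).
rewrite (finmu _ (measurableD mB mD)) (finmu _ (measurableD mD mB)).
rewrite -EFinM -EFinD !lte_fin !lee_fin -/b.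
move: (fine (mu D)) (fine (mu (B `\` D))) (fine (mu (D `\` B))) => x y z.
move=> yr zr bxy exz.
have rE : r * (1 + e) = e * b / 2 by rewrite /r; field; rewrite gt_eqF// addr_gt0.
have : 0 < e * b by rewrite mulr_gt0.
have : e * b <= e * (x + y) by rewrite ler_wpM2l// ltW.
have : e * y < e * r by rewrite ltr_pM2l.
lra.
Qed.

Lemma small_cylinders (e : R) :
  (fun n => \prod_(i < n)
     \big[Num.max/0]_(a : digit alpha_ge2 i) fine (m i [set a]))
    @ \oo --> (0 : R) ->
  0 < e -> exists n, forall a, (mu (cylinder n a) < e%:E)%E.
Proof.
move=> /cvgrPdist_lt cvg0 e0; have [n _ /(_ n (leqnn n))/=] := cvg0 e e0.
rewrite sub0r normrN => hn; exists n => a; rewrite mu_cylinder.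
rewrite (eq_bigr (fun i : 'I_n => (fine (m i [set a i]))%:E)); last first.
  by move=> i _; rewrite fineK// fin_num_measure.
rewrite prodEFin lte_fin; apply: le_lt_trans hn.
apply: le_trans (ler_norm _); apply: ler_prod => i _.
by rewrite fine_ge0//= (le_bigmax _ (fun b : digit alpha_ge2 i => fine (m i [set b]))).
Qed.

End product_measure.

(** * Vanishing sets *)

Section vanishing_sets.
Context (R : realType) (alpha : nat -> nat).
Context (alpha_ge2 : forall n, (2 <= alpha n)%N).
Local Notation X := (odometer_space alpha_ge2).
Local Notation f := (odometer alpha_ge2).
Context (m : forall n, probability (digit alpha_ge2 n) R).
Context (mu : probability X R) (mu_prod : is_product_probability m mu).
Implicit Types (x y a : X) (A B D E : set X) (n k : nat).

(** Replacing the prefix of an orbit point by [a] amounts to moving along the orbit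
from the current counter to that of [a] without wrapping around.  This may
require going backwards, by less than a period; starting one period late turns
this into a forward move. *)
Lemma replace_prefix_orbit n a x k :
  exists2 j, (j < (2 * period alpha n).+1)%N &
    replace_prefix n a (iter (k + period alpha n) f x) = iter j f (iter k f x).
Proof.
set N := period alpha n; set y := iter (k + N) f x.
have ltN (z : X) : (counter n z < N)%N by exact: counter_lt.
have [ya|ay] := leqP (counter n y) (counter n a).
  pose t := (counter n a - counter n y)%N.
  exists (N + t)%N; first by have := ltN a; rewrite /t; lia.
  have yt : (counter n y + t < N)%N by rewrite /t subnKC.
  have -> : iter (N + t) f (iter k f x) = iter t f y.
    by rewrite /y -!iterD; congr (iter _ f x); lia.
  have : agree n (iter t f y) a.
    by apply/counterP; rewrite counter_iter modn_small// /t subnKC.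
  move=> ag; apply: functional_extensionality_dep => i; rewrite /replace_prefix.
  by case: ltnP => [/ag ->//|ni]; rewrite (iter_tail yt).
pose t := (counter n y - counter n a)%N.
have tN : (t <= N)%N by have := ltN y; rewrite /t; lia.
exists (N - t)%N; first by lia.
set z := iter _ f _.
have yz : y = iter t f z.
  by rewrite /y /z -!iterD; congr (iter _ f x); lia.
have cy : counter n y = ((counter n z + t) %% N)%N by rewrite yz counter_iter.
have zt : (counter n z + t = counter n y)%N.
  have := ltN z; have := ltN y; move: cy; rewrite /t.
  have [h|h] := ltnP (counter n z + t) N; first by rewrite modn_small.
  rewrite -(subnK h) modnDr modn_small; last by have := ltN z; lia.
  by have := ltN z; rewrite /t in h *; lia.
have ag : agree n z a by apply/counterP; rewrite /t in zt; lia.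
apply: functional_extensionality_dep => i; rewrite /replace_prefix.
case: ltnP => [/ag ->//|ni].
by rewrite yz (@iter_tail _ _ n)// zt.
Qed.

Definition vanishing B := forall e : R, 0 < e ->
  exists n, (mu (iter n f @^-1` B) < e%:E)%E.

Context (mf : measurable_fun setT f).
Context (nonsing : forall e : R, 0 < e -> exists2 r : R, 0 < r &
  forall E, measurable E -> (mu E < r%:E)%E -> (mu (f @^-1` E) < e%:E)%E).

Lemma preimage_iterS n B : iter n.+1 f @^-1` B = f @^-1` (iter n f @^-1` B).
Proof. by apply/seteqP; split => x /=; rewrite -iterS iterSr. Qed.

Lemma preimage_iterD n k B :
  iter (n + k) f @^-1` B = iter k f @^-1` (iter n f @^-1` B).
Proof. by apply/seteqP; split => x /=; rewrite iterD. Qed.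

Lemma measurable_preimage_iter n B : measurable B -> measurable (iter n f @^-1` B).
Proof.
move=> mB; elim: n => [//|n IH].
by rewrite preimage_iterS -[X in measurable X]setTI; exact: mf.
Qed.

(** Only boundedly many iterates are controlled at once: nothing prevents the
modulus [r] from degenerating with [k]. *)
Lemma nonsingular_iter k (e : R) : 0 < e -> exists2 r : R, 0 < r &
  forall E, measurable E -> (mu E < r%:E)%E ->
    forall n, (n <= k)%N -> (mu (iter n f @^-1` E) < e%:E)%E.
Proof.
elim: k e => [|k IH] e e0.
  by exists e => // E mE Ee n; rewrite leqn0 => /eqP ->.
have [r r0 hr] := nonsing e0; have re0 : 0 < Num.min r e by rewrite lt_min r0.
have [s s0 hs] := IH _ re0; exists s => // E mE Es [|n] nk.
  by apply: lt_le_trans (hs E mE Es 0%N _) _ => //; rewrite lee_fin ge_min lexx orbT.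
rewrite preimage_iterS; apply: hr; first exact: measurable_preimage_iter.
by apply: lt_le_trans (hs E mE Es n _) _ => //; rewrite lee_fin ge_min lexx.
Qed.

(** The set [A] consists of the points which fall in [B] once their prefix is
replaced by that of a cylinder nearly filled by [B]. *)
Lemma vanishing_large B (e : R) : measurable B -> (0 < mu B)%E -> vanishing B ->
  0 < e -> exists A, [/\ measurable A, (mu (~` A) < e%:E)%E & vanishing A].
Proof.
move=> mB B0 vB e0; have [n [a na]] := cylinder_density mB B0 e0.
have mr := @measurable_replace_prefix alpha alpha_ge2 n a.
have mrB C : measurable C -> measurable (replace_prefix n a @^-1` C).
  by move=> mC; rewrite -[X in measurable X]setTI; exact: mr.
exists (replace_prefix n a @^-1` B); split; first exact: mrB.
  have h : (mu (cylinder n a) * mu (~` (replace_prefix n a @^-1` B)) =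
      mu (cylinder n a `\` B))%E.
    have := replace_prefix_measure mu_prod n a (measurableC mB).
    by rewrite setIC -setDE.
  rewrite ltNge; apply/negP => eA.
  move: na; rewrite -h muleC ltNge => /negP; apply.
  by rewrite lee_wpmul2r.
move=> r r0; set N := period alpha n; set M := (2 * N).+1.
have rM : 0 < r / 2 / M%:R by rewrite !divr_gt0.
have [s s0 hs] := nonsingular_iter M rM.
have [k kB] := vB s s0; exists (k + N)%N.
have mk := measurable_preimage_iter k mB.
have mkB j : measurable (iter j f @^-1` (iter k f @^-1` B)).
  exact: measurable_preimage_iter.
have mA := measurable_preimage_iter (k + N) (mrB _ mB).
apply: (@le_lt_trans _ _ (\sum_(j < M) mu (iter j f @^-1` (iter k f @^-1` B)))%E).
  apply: (@content_subadditive _ _ _ mu _ (fun j => iter j f @^-1` (iter k f @^-1` B)) M) => //.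
  rewrite -(bigcup_mkord M (fun j => iter j f @^-1` (iter k f @^-1` B))) => x /= Bx.
  have [j jM hj] := replace_prefix_orbit n a x k; exists j => //=.
  by rewrite -iterD addnC iterD -hj.
apply: (@le_lt_trans _ _ (\sum_(j < M) (r / 2 / M%:R)%:E)%E).
  apply: lee_sum => j _; apply/ltW/(hs _ mk kB).
  exact: ltnW (ltn_ord j).
rewrite sumEFin sumr_const card_ord -[_ *+ M]mulr_natr divfK ?pnatr_eq0// lte_fin.
by rewrite ltr_pdivrMr// ltr_pMr// ltr1n.
Qed.

(** A small preimage remains small under a bounded number of further pullbacks, and
[q] consecutive exponents represent all residues modulo [q]. *)
Lemma vanishing_residue A (q c : nat) (e : R) : (0 < q)%N -> measurable A ->
  vanishing A -> 0 < e ->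
  exists n, [/\ (1 <= n)%N, n = c %[mod q] & (mu (iter n f @^-1` A) < e%:E)%E].
Proof.
move=> q0 mA vA e0; have [r r0 hr] := nonsingular_iter (2 * q) e0.
have [k kA] := vA r r0.
(* the summand q ensures that the exponent is positive *)
pose j := (q + (c + (q - k %% q)) %% q)%N.
have jq : (j <= 2 * q)%N by rewrite /j; have := ltn_pmod (c + (q - k %% q)) q0; lia.
exists (k + j)%N; split.
- by rewrite /j; lia.
- rewrite /j addnCA modnDl modnDmr.
  have -> : (k + (c + (q - k %% q)) = (k %/ q).+1 * q + c)%N.
    by have := divn_eq k q; have := ltn_pmod k q0; rewrite mulSn; lia.
  by rewrite modnMDl.
- by rewrite preimage_iterD; apply: hr => //; exact: measurable_preimage_iter.
Qed.

(** Here [E] is a large vanishing set [A], and [D] the [k]-th preimage of a set [C]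
of finite level close to [A], where [k] makes the preimage of [A] small.  Choosing
[n] so that [n + k] is a multiple of the period of [C] makes the [n]-th preimage
of [D] equal to [C], which is large. *)
Lemma transitive_sets B (e : R) : measurable B -> (0 < mu B)%E -> vanishing B ->
  0 < e -> exists n D E, [/\ (1 <= n)%N, measurable D /\ measurable E,
    (mu D < e%:E)%E /\ (mu (~` (iter n f @^-1` D)) < e%:E)%E &
    (mu (~` E) < e%:E)%E /\ (mu (iter n f @^-1` E) < e%:E)%E].
Proof.
move=> mB B0 vB e0; have e20 : 0 < e / 2 by rewrite divr_gt0.
have elt : ((e / 2)%:E < e%:E)%E by rewrite lte_fin ltr_pdivrMr// ltr_pMr// ltr1n.
have [A [mA A1 vA]] := vanishing_large mB B0 vB e20.
have [k kA] := vA _ e20.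
have [s s0 hs] := nonsingular_iter k e20.
have se0 : 0 < Num.min s (e / 2) by rewrite lt_min s0.
have [C lC [AC CA]] := finite_level_approximation mu mA se0.
have mC := finite_level_measurable lC.
have [l lCl] := lC.
have [n [n1 nk nA]] := vanishing_residue (k * (period alpha l).-1)
  (period_gt0 alpha_ge2 l) mA vA e0.
exists n, (iter k f @^-1` C), A; split => //.
- by split => //; exact: measurable_preimage_iter.
- split.
    have mCA := measurableD mC mA.
    apply: (@mu_lt_half _ _ _ mu (iter k f @^-1` A) (iter k f @^-1` (C `\` A))) => //.
    + exact: measurable_preimage_iter.
    + exact: measurable_preimage_iter.
    + exact: measurable_preimage_iter.
    + by move=> x /= Cx; have [Ax|Ax] := pselect (A (iter k f x)); [left|right].
    + by apply: hs => //; apply: lt_le_trans CA _; rewrite lee_fin ge_min lexx.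
  rewrite -preimage_iterD.
  have -> : iter (k + n) f @^-1` C = C.
    have [t tE] : exists t, (k + n = t * period alpha l)%N.
      apply/dvdnP; rewrite /dvdn -modnDmr nk modnDmr -mulnS.
      by rewrite prednK ?period_gt0// modnMl.
    rewrite tE; apply/seteqP; split => x.
      by apply: lCl; apply: agree_sym; exact: iter_period_agree.
    by apply: lCl; exact: iter_period_agree.
  apply: (mu_lt_half (measurableC mA) (measurableD mA mC) (measurableC mC)) => //.
    by move=> x Cx; have [Ax|Ax] := pselect (A x); [right|left].
  by apply: lt_le_trans AC _; rewrite lee_fin ge_min lexx orbT.
by split => //; exact: lt_trans elt.
Qed.

End vanishing_sets.

(** * Level sets of a nonzero function *)

Section annulus.
Context d (T : measurableType d) (R : realType) (k : base_field).
Context (mu : probability T R) (p : R) (p1 : 1 <= p).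
Local Notation K := (scalars R k).

(** The ratio 2 bounds the distortion of the modulus of [g]. *)
Definition annulus (g : T -> K) (a : R) : set T :=
  [set x | a <= modulus (g x) < 2 * a].

Lemma measurable_annulus (g : T -> K) (a : R) :
  measurable_fun setT (g : T -> borel_scalars R k) -> measurable (annulus g a).
Proof.
move=> /measurable_modulus mg.
have := mg measurableT _ (measurable_itv `[a, 2 * a[); rewrite setTI.
by congr measurable; apply/seteqP; split => x /=; rewrite in_itv.
Qed.

Lemma nonzero_annulus (g : T -> K) : g \in Lpfun mu p1 -> Lpof mu p1 g <> 0 ->
  exists2 a : R, 0 < a & (0 < mu (annulus g a))%E.
Proof.
move=> gL g0; have mg := Lpfun_measurable gL.
apply: contrapT => na; apply: g0.
pose q n : R := ratr (odflt 0 (unpickle n : option rat)).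
pose F n := [set x | 0 < q n /\ annulus g (q n) x].
have F0 n : mu.-negligible (F n).
  have [qn|qn] := ltP 0 (q n); last first.
    rewrite (_ : F n = set0); first exact: negligible_set0.
    by apply/seteqP; split => // x []; rewrite ltNge qn.
  exists (annulus g (q n)); split.
  - exact: measurable_annulus.
  - apply/eqP; rewrite eq_le measure_ge0 andbT leNgt; apply/negP => h.
    by apply: na; exists (q n).
  - by move=> x [].
rewrite -(Lpof0 k mu p1); apply/Lpclass_eqP.
rewrite val_Lpof// val_Lpof ?rpred0//.
apply: negligibleS (negligible_bigcup F0) => x /= gx.
have gx0 : 0 < modulus (g x).
  rewrite lt_neqAle modulus_ge0 andbT eq_sym; apply/eqP => /modulus_eq0 gx0.
  exact: gx.
have [|r] := @rat_in_itvoo R (modulus (g x) / 2) (modulus (g x)).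
  by rewrite ltr_pdivrMr// ltr_pMr// ltr1n.
rewrite in_itv/= => /andP[r1 r2]; exists (pickle r) => //.
rewrite /F /annulus /= /q pickleK /=; split; first by apply: lt_trans r1; rewrite divr_gt0.
by rewrite (ltW r2)/= mulrC -ltr_pdivrMr.
Qed.

End annulus.

(** * The composition operator of the odometer *)

Section odometer_operator.
Context (R : realType) (k : base_field) (p : R) (p_ge1 : 1 <= p).
Context (alpha : nat -> nat) (alpha_ge2 : forall n, (2 <= alpha n)%N).
Local Notation X := (odometer_space alpha_ge2).
Local Notation f := (odometer alpha_ge2).
Local Notation K := (scalars R k).
Context (m : forall n, probability (digit alpha_ge2 n) R).
Context (mu : probability X R) (mu_prod : is_product_probability m mu).
Context (Tf : {linear Lp k mu p_ge1 -> Lp k mu p_ge1}).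
Context (Tf_comp : is_composition_operator f Tf) (Tf_continuous : continuous Tf).
Local Notation measurableK g :=
  (measurable_fun setT (g : X -> borel_scalars R k)).
Local Notation LF := (Lpfun mu p_ge1).
Local Notation ind B := (cut B (cst (1 : K))).
Local Notation cls := (Lpof mu p_ge1).
Implicit Types (g h : X -> K) (B D E : set X).

Lemma comp_Lpof g : g \in LF -> g \o f \in LF /\ Tf (cls g) = cls (g \o f).
Proof.
move=> gL; have [h [hE Th]] := Tf_comp (insubd 0 g).
rewrite val_Lpof// in hE; rewrite -hE; split; first exact: valP.
by rewrite Lpof_val -Th.
Qed.

Lemma comp_iter_Lpof n g : g \in LF ->
  g \o iter n f \in LF /\ iter n Tf (cls g) = cls (g \o iter n f).
Proof.
elim: n g => [//|n IH] g gL.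
have [gfL Tng] := IH g gL; have [gffL Tg] := comp_Lpof gfL.
rewrite [iter n.+1 Tf _]iterS Tng.
have -> : g \o iter n.+1 f = (g \o iter n f) \o f.
  by apply/funext => x; rewrite /= -iterS iterSr.
by [].
Qed.

Lemma cut1_Lpfun B : measurable B -> ind B \in LF.
Proof. by move=> mB; apply: cut_Lpfun => //; exact: cst1_Lpfun. Qed.

(** Measurability of the odometer is part of the assumption that composition with
it preserves Lp. *)
Lemma odometer_measurable : measurable_fun setT f.
Proof.
move=> _ B mB; rewrite setTI.
have [h _] := comp_Lpof (cut1_Lpfun mB).
have /measurable_scalarsP := Lpfun_measurable h.
move=> /(_ _ (@open_modulus_ball R k 1 (modulus (1 : K)))).
congr measurable; apply/seteqP; split => x /=.
  have [Bx|Bx] := pselect (B (f x)); first by [].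
  by rewrite cut_out// subr0 ltxx.
move=> Bx; rewrite cut_in//= subrr modulus0 lt_neqAle modulus_ge0 andbT eq_sym.
by apply/eqP => /modulus_eq0 /eqP; rewrite oner_eq0.
Qed.

(** Continuity of the operator at 0, read on indicator functions. *)
Lemma odometer_nonsingular (e : R) : 0 < e -> exists2 r : R, 0 < r &
  forall E, measurable E -> (mu E < r%:E)%E -> (mu (f @^-1` E) < e%:E)%E.
Proof.
move=> e0.
have [r r0 hr] := small_norm_small_set k mu p_ge1 ltr01 e0.
have /continuous_nrmP/(_ 0 r r0)[s s0 hs] := Tf_continuous.
have [t t0 ht] := small_support_small_norm k mu p_ge1 ler01 s0.
exists t => // E mE Et; have cL := cut1_Lpfun mE.
have [cfL Tc] := comp_Lpof cL.
have -> : f @^-1` E = [set x | (1 <= modulus ((ind E \o f) x))%R].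
  apply/seteqP; split => x /=.
    by move=> Ex; rewrite cut_in//= modulus1.
  have [//|Ex] := pselect (E (f x)).
  by rewrite cut_out// modulus0 ler10.
apply: hr => //; rewrite -Tc -[X in nrm X]subr0 -(linear0 Tf); apply: hs.
rewrite subr0; apply: (ht _ E) => //.
- exact: Lpfun_measurable cL.
- by move=> x; apply: le_trans (modulus_cut _ _ _) _; rewrite modulus1.
- by move=> x Ex; rewrite cut_out.
Qed.

Definition finite_level_fun g := exists n, forall x y, agree n x y -> g x = g y.

Lemma finite_level_fun_preimage g (U : set K) :
  finite_level_fun g -> finite_level (g @^-1` U).
Proof. by move=> [n ng]; exists n => x y xy /=; rewrite (ng _ _ xy). Qed.

Lemma finite_level_fun_measurable g : finite_level_fun g -> measurableK g.
Proof.
move=> fg; apply/measurable_scalarsP => U _.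
by apply: finite_level_measurable; exact: finite_level_fun_preimage.
Qed.

Lemma finite_level_fun_counter g : finite_level_fun g ->
  exists n (v : nat -> K), forall x, g x = v (counter n x).
Proof.
move=> [n ng]; exists n.
have /choice[v hv] (j : nat) : exists y : K, forall x, counter n x = j -> g x = y.
  have [[x xj]|nx] := pselect (exists x : X, counter n x = j); last first.
    by exists 0 => x xj; exfalso; apply: nx; exists x.
  by exists (g x) => y yj; apply: ng; apply/counterP; rewrite xj yj.
by exists v => x; apply: hv.
Qed.

Lemma finite_level_fun_bounded g : finite_level_fun g ->
  exists M : R, forall x, modulus (g x) <= M.
Proof.
move=> /finite_level_fun_counter[n [v gv]].
exists (\sum_(j < period alpha n) modulus (v j)) => x.
rewrite gv (bigD1 (Ordinal (counter_lt n x)))//= lerDl.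
by apply: sumr_ge0 => j _; exact: modulus_ge0.
Qed.

Lemma finite_level_fun_Lpfun g : finite_level_fun g -> g \in LF.
Proof.
move=> fg; have [M gM] := finite_level_fun_bounded fg.
by apply: bounded_Lpfun gM; exact: finite_level_fun_measurable.
Qed.

(** By [Lpof_density] it suffices to approximate indicators, and by
[finite_level_approximation] sets of finite level suffice for that. *)
Lemma finite_level_fun_dense : dense [set cls g | g in finite_level_fun].
Proof.
apply: Lpof_density.
- exists 0; first by exists 0%N.
  exact: Lpof0.
- move=> a _ _ [g fg <-] [h fh <-]; exists (a *: g + h); last first.
    by rewrite LpofD//; exact: finite_level_fun_Lpfun.
  have [n ng] := fg; have [l lh] := fh; exists (maxn n l) => x y xy.
  rewrite -[LHS]/(a * g x + h x) -[RHS]/(a * g y + h y).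
  rewrite (ng x y) ?(lh x y)//; first exact: agree_le (leq_maxr _ _) xy.
  exact: agree_le (leq_maxl _ _) xy.
move=> B e mB e0.
have [r r0 hr] := small_support_small_norm k mu p_ge1 ler01 e0.
have r20 : 0 < r / 2 by rewrite divr_gt0.
have [D lD [BD DB]] := finite_level_approximation mu mB r20.
have mD := finite_level_measurable lD.
have fD : finite_level_fun (ind D).
  have [n nD] := lD; exists n => x y xy.
  have [Dx|Dx] := pselect (D x); first by rewrite !cut_in//; exact: nD xy Dx.
  rewrite !cut_out// => Dy; apply: Dx; apply: nD Dy; exact: agree_sym.
exists (cls (ind D)); first by exists (ind D).
have DL := cut1_Lpfun mD; have BL := cut1_Lpfun mB.
have mBD := measurableD mB mD; have mDB := measurableD mD mB.
rewrite -LpofB//; apply: (hr _ ((B `\` D) `|` (D `\` B))).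
- by apply: (@Lpfun_measurable _ _ _ _ mu p p_ge1); rewrite rpredB.
- exact: measurableU.
- apply: (mu_lt_half mBD mDB) => //; exact: measurableU.
- move=> x; rewrite -[(_ - _) x]/(ind D x - ind B x).
  have [Dx|Dx] := pselect (D x); have [Bx|Bx] := pselect (B x);
    rewrite ?(cut_in _ Dx) ?(cut_in _ Bx) ?(cut_out _ Dx) ?(cut_out _ Bx) /=.
  + by rewrite subrr modulus0 ler01.
  + by rewrite subr0 modulus1.
  + by rewrite sub0r modulusN modulus1.
  + by rewrite subrr modulus0 ler01.
move=> x nx; rewrite -[(_ - _) x]/(ind D x - ind B x).
have [Dx|Dx] := pselect (D x); have [Bx|Bx] := pselect (B x);
  rewrite ?(cut_in _ Dx) ?(cut_in _ Bx) ?(cut_out _ Dx) ?(cut_out _ Bx) ?subrr//.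
- by exfalso; apply: nx; right.
- by exfalso; apply: nx; left.
Qed.

(** A countable family of functions of finitely many digits: the list gives the
value on each cylinder, indexed by the counter. *)
Definition rational_level (t : nat * seq (rat * rat)) : X -> K :=
  fun x => rat_point R k (nth (0, 0) t.2 (counter t.1 x)).

Lemma rational_level_fun t : finite_level_fun (rational_level t).
Proof. by exists t.1 => x y /counterP xy; rewrite /rational_level xy. Qed.

Lemma rational_level_dense : dense (range (cls \o rational_level)).
Proof.
apply/dense_nrmP => u e e0; have e20 : 0 < e / 2 by rewrite divr_gt0.
have /dense_nrmP/(_ u _ e20)[_ [g fg <-] gu] := finite_level_fun_dense.
have [n [v gv]] := finite_level_fun_counter fg.
have /choice[q hq] j := rat_point_dense (v j) e20.
pose t := (n, mkseq q (period alpha n)).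
exists (cls (rational_level t)); first by exists t.
apply: le_lt_trans (ler_nrm_triangle _ (cls g) _) _.
rewrite [ltRHS]splitr ler_ltD//.
have gL := finite_level_fun_Lpfun fg.
have tL := finite_level_fun_Lpfun (rational_level_fun t).
rewrite -LpofB//; apply: nrm_bounded.
  by apply: (@Lpfun_measurable _ _ _ _ mu p p_ge1); rewrite rpredB.
move=> x; rewrite -[(_ - _) x]/(rational_level t x - g x).
rewrite /rational_level /= nth_mkseq ?counter_lt// gv -modulusN opprB.
exact: ltW.
Qed.

Lemma finite_level_fun_periodic g : finite_level_fun g ->
  exists2 n, (1 <= n)%N & g \o iter n f = g.
Proof.
move=> [n ng]; exists (period alpha n); first exact: period_gt0.
apply/funext => x /=; apply: ng; apply: agree_sym.
by have := @iter_period_agree alpha alpha_ge2 n 1 x; rewrite mul1n.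
Qed.

Lemma periodic_points_dense : dense [set u | periodic_point Tf u].
Proof.
have /dense_nrmP dS := finite_level_fun_dense.
apply/dense_nrmP => u e e0; have [_ [g fg <-] gu] := dS u e e0.
exists (cls g) => //; have [n n1 ng] := finite_level_fun_periodic fg.
exists n; split => //.
by have [_ ->] := comp_iter_Lpof n (finite_level_fun_Lpfun fg); rewrite ng.
Qed.

(** Transitivity from [transitive_sets]: given a bounded [u] and a target [w] of
level [l], the function [z] equal to [u] on [E], plus a translate of [w] on [D],
differs from [u] only off [E] and on [D], while its [n]-th pullback differs from
[w] only on the [n]-th preimage of [E] and off that of [D].  All four sets are
small and all functions bounded. *)
Lemma vanishing_hypercyclic B : measurable B -> (0 < mu B)%E ->
  vanishing mu B -> hypercyclic Tf.
Proof.
move=> mB B0 vB.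
pose Q : set (X -> K) := [set g | measurableK g /\ exists M : R, forall x, modulus (g x) <= M].
have QL g : Q g -> g \in LF by move=> [mg [M gM]]; exact: bounded_Lpfun gM.
apply: (@hypercyclic_of_transitive _ X R k mu p p_ge1 _ (cls \o rational_level) Tf Q) => //.
- exact: rational_level_dense.
- exists (cst 0); split; first exact: measurable_cst.
  by exists 0 => x; rewrite /= modulus0.
move=> u i e [meas_u [M uM]] e0.
pose w := rational_level i; have fw : finite_level_fun w by exact: rational_level_fun.
have wL := finite_level_fun_Lpfun fw.
have [M' wM'] := finite_level_fun_bounded fw.
have uL : u \in LF by exact: bounded_Lpfun uM.
have M0 : 0 <= M by apply: le_trans (uM point); exact: modulus_ge0.
have M'0 : 0 <= M' by apply: le_trans (wM' point); exact: modulus_ge0.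
have N0 : 0 <= 2 * M + 2 * M' by rewrite addr_ge0// mulr_ge0.
have [r r0 hr] := small_support_small_norm k mu p_ge1 N0 e0.
have re0 : 0 < Num.min r e / 2 by rewrite divr_gt0// lt_min r0.
have [n [D [E [n1 [mD mE] [D1 D2] [E1 E2]]]]] :=
  transitive_sets mu_prod odometer_measurable odometer_nonsingular mB B0 vB re0.
have [l wl] := fw.
(* n + c is a multiple of the period of w, so w' is w moved back by n *)
pose c := (n * (period alpha l).-1)%N.
pose w' := w \o iter c f.
have w'L : w' \in LF by have [] := comp_iter_Lpof c wL.
have w'n x : w' (iter n f x) = w x.
  rewrite /w' /= -iterD addnC -mulnS prednK ?period_gt0//.
  by apply: wl; apply: agree_sym; exact: iter_period_agree.
pose z := cut E u + cut D w'.
have zE x : z x = cut E u x + cut D w' x by [].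
have zL : z \in LF by rewrite rpredD// cut_Lpfun.
have zM x : modulus (z x) <= M + M'.
  rewrite zE (le_trans (ler_modulusD _ _))// lerD//.
    exact: le_trans (modulus_cut _ _ _) (uM _).
  by apply: le_trans (modulus_cut D w' x) _; exact: wM'.
have lt_r (A : set X) : measurable A -> (mu A < (Num.min r e)%:E)%E -> (mu A < r%:E)%E.
  by move=> mA /lt_le_trans; apply; rewrite lee_fin ge_min lexx.
have lt_e (A : set X) : measurable A -> (mu A < (Num.min r e)%:E)%E -> (mu A < e%:E)%E.
  by move=> mA /lt_le_trans; apply; rewrite lee_fin ge_min lexx orbT.
have mF : measurable (~` E `|` D) by apply: measurableU => //; exact: measurableC.
have muF := mu_lt_half (measurableC mE) mD mF (@subset_refl _ _) E1 D1.
have zu x : ~ (~` E `|` D) x -> z x = u x.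
  move=> nx; rewrite zE cut_in; last by apply: contrapT => Ex; apply: nx; left.
  by rewrite cut_out ?addr0// => Dx; apply: nx; right.
exists z, n, (~` E `|` D); split => //.
- by split; [exact: Lpfun_measurable zL|exists (M + M')].
- by split => //; exact: lt_e.
split.
  apply: (hr _ (~` E `|` D)) => //; last 1 first.
  - by move=> x /zu zx; rewrite -[(_ - _) x]/(z x - u x) zx subrr.
  - by apply: (@Lpfun_measurable _ _ _ _ mu p p_ge1); rewrite rpredB.
  - exact: lt_r.
  - move=> x; rewrite -[(_ - _) x]/(z x - u x) (le_trans (ler_modulusD _ _))// modulusN.
    by have := zM x; have := uM x; lra.
have [znL ->] := comp_iter_Lpof n zL; rewrite /= -LpofB//.
have mE' := measurable_preimage_iter odometer_measurable n mE.
have mD' := measurableC (measurable_preimage_iter odometer_measurable n mD).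
have mF' := measurableU _ _ mE' mD'.
have muF' := mu_lt_half mE' mD' mF' (@subset_refl _ _) E2 D2.
apply: (hr _ (iter n f @^-1` E `|` ~` (iter n f @^-1` D))) => //.
- by apply: (@Lpfun_measurable _ _ _ _ mu p p_ge1); rewrite rpredB.
- exact: lt_r.
- move=> x; rewrite -[(_ - _) x]/(z (iter n f x) - w x).
  rewrite (le_trans (ler_modulusD _ _))// modulusN.
  by have := zM (iter n f x); have := wM' x; lra.
move=> x nx; rewrite -[(_ - _) x]/(z (iter n f x) - w x) zE.
rewrite cut_out; last by move=> Ex; apply: nx; left.
rewrite cut_in; last by apply: contrapT => Dx; apply: nx; right.
by rewrite add0r w'n subrr.
Qed.

Lemma small_orbit_vanishing u : u <> 0 ->
  (forall e : R, 0 < e -> exists n, nrm (iter n Tf u) < e) ->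
  exists B, [/\ measurable B, (0 < mu B)%E & vanishing mu B].
Proof.
have [g gL ->] := LpofP u; move=> g0 small.
have [a a0 mua] := nonzero_annulus gL g0.
have mA := measurable_annulus a (Lpfun_measurable gL).
exists (annulus g a); split => // e e0.
have [r r0 hr] := small_norm_small_set k mu p_ge1 a0 e0.
have [n nr] := small r r0; exists n.
have [gnL gnE] := comp_iter_Lpof n gL; rewrite gnE in nr.
apply: mu_sub_lt (hr _ gnL nr).
- exact: measurable_preimage_iter odometer_measurable _ _ mA.
- by apply: measurable_modulus_ge; exact: Lpfun_measurable gnL.
- by move=> x /andP[].
Qed.

(** On the annulus the modulus of [g] varies by a factor less than 2, and so does
that of any multiple of [g].  If a multiple of a pullback of [g] is within 1/2 of
a function whose values are distinct powers of 8 on the cylinders of depth [n],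
two points of the pulled back annulus cannot lie in distinct cylinders, for their
moduli would differ by a factor of at least 2. *)
Lemma supercyclic_vanishing :
  (forall e : R, 0 < e -> exists n, forall a : X, (mu (cylinder n a) < e%:E)%E) ->
  supercyclic Tf ->
  exists B, [/\ measurable B, (0 < mu B)%E & vanishing mu B].
Proof.
move=> small [u /dense_nrmP du]; have [g gL uE] := LpofP u; rewrite uE in du.
have [a a0 mua] : exists2 a : R, 0 < a & (0 < mu (annulus g a))%E.
  apply: nonzero_annulus (gL) _ => g0.
  have one0 : 0 < nrm (cls (cst (1 : K))).
    rewrite lt_neqAle nrm_ge0 andbT eq_sym.
    by apply: contra_neq (Lpof1_neq0 k mu p_ge1); exact: nrm_eq0.
  have [_ [l [n [_ ->]]]] := du (cls (cst 1)) _ one0.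
  by rewrite g0 iter_linear0 scaler0 sub0r nrmN ltxx.
have mA := measurable_annulus a (Lpfun_measurable gL).
exists (annulus g a); split => // e e0.
have e20 : 0 < e / 2 by rewrite divr_gt0.
have half0 : 0 < 2^-1 :> R by rewrite invr_gt0.
have [n hn] := small _ e20.
pose psi : X -> K := fun x => of_real k (8 ^+ counter n x).
have fpsi : finite_level_fun psi by exists n => x y /counterP xy; rewrite /psi xy.
have psiL := finite_level_fun_Lpfun fpsi.
have [r r0 hr] := small_norm_small_set k mu p_ge1 half0 e20.
have [_ [l [t [_ ->]]]] := du (cls psi) r r0.
have [gtL ->] := comp_iter_Lpof t gL.
pose h := l *: (g \o iter t f) - psi.
have hL : h \in LF by rewrite rpredB// rpredZ.
have hE x : h x = l * g (iter t f x) - psi x by [].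
rewrite (_ : _ - _ = cls h); last first.
  by rewrite LpofB ?rpredZ// -[l *: (_ \o _)]addr0 LpofD ?rpred0// Lpof0 addr0.
move=> /(hr _ hL); set bad := [set x | _] => mubad.
have mbad : measurable bad by apply: measurable_modulus_ge; exact: Lpfun_measurable hL.
have mA' := measurable_preimage_iter odometer_measurable t mA.
exists t.
have psiM x : modulus (psi x) = 8 ^+ counter n x.
  apply: (@of_real_inj R k); rewrite of_real_modulus /psi ger0_norm//.
  by rewrite -(@of_real0 R k) ler_of_real exprn_ge0.
have key x y : annulus g a (iter t f x) -> annulus g a (iter t f y) ->
    ~ bad x -> ~ bad y -> ~ (counter n x < counter n y)%N.
  have near (v : X) : ~ bad v ->
      modulus l * modulus (g (iter t f v)) < 8 ^+ counter n v + 2^-1 /\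
      8 ^+ counter n v < modulus l * modulus (g (iter t f v)) + 2^-1.
    move=> /negP; rewrite -ltNge => hv; rewrite -modulusM; split.
      have := ler_modulusD (h v) (psi v); rewrite {1}hE subrK psiM; lra.
    have := ler_modulusD (- h v) (l * g (iter t f v)).
    by rewrite modulusN {1}hE opprB subrK psiM; lra.
  move=> /andP[ax xa] /andP[ay ya] /near[bx _] /near[_ by_] xy.
  have Gyx : modulus l * modulus (g (iter t f y)) <=
      2 * (modulus l * modulus (g (iter t f x))).
    rewrite mulrCA ler_wpM2l ?modulus_ge0//; lra.
  have pow1 : 1 <= 8 ^+ counter n x :> R by rewrite exprn_ege1// ler1n.
  have pow8 : 8 * 8 ^+ counter n x <= 8 ^+ counter n y :> R.
    by rewrite -exprS ler_weXn2l// ler1n.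
  move: bx by_ Gyx pow1 pow8.
  move: (8 ^+ counter n x) (8 ^+ counter n y) (modulus l * _) (modulus l * _).
  move=> P P' G G'; lra.
have [[x [Ax bx]]|nx] := pselect (exists x, annulus g a (iter t f x) /\ ~ bad x).
  apply: (mu_lt_half mbad (cylinder_measurable n x) mA' _ mubad (hn x)) => y Ay.
  have [by_|by_] := pselect (bad y); first by left.
  have [lt_xy|lt_yx|xy] := ltngtP (counter n x) (counter n y).
  - by case: (key x y).
  - by case: (key y x).
  - by right; exact: (proj1 (counterP n x y)).
apply: lt_trans (_ : ((e / 2)%:E < e%:E)%E); last first.
  by rewrite lte_fin ltr_pdivrMr// ltr_pMr// ltr1n.
apply: mu_sub_lt mubad => // x Ax; apply: contrapT => bx; apply: nx.
by exists x.
Qed.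

End odometer_operator.

Theorem theoremC (R : realType) (k : base_field) (p : R) (p_ge1 : 1 <= p)
    (alpha : nat -> nat) (alpha_ge2 : forall n, (2 <= alpha n)%N)
    (m : forall n, probability (digit alpha_ge2 n) R)
    (m_gt0 : forall n (a : digit alpha_ge2 n), (0 < m n [set a])%E)
    (mu : probability (odometer_space alpha_ge2) R)
    (mu_prod : is_product_probability m mu)
    (mu_nonatomic :
      (fun n => \prod_(i < n)
         \big[Num.max/0]_(a : digit alpha_ge2 i) fine (m i [set a]))
        @ \oo --> (0 : R))
    (Tf : {linear Lp k mu p_ge1 -> Lp k mu p_ge1})
    (Tf_comp : is_composition_operator (odometer alpha_ge2) Tf)
    (Tf_continuous : continuous Tf) :
  [<-> Li_Yorke_chaotic Tf;
       supercyclic Tf;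
       hypercyclic Tf;
       Devaney_chaotic Tf].
Proof.
have vanish_hc B : measurable B -> (0 < mu B)%E ->
    vanishing mu B -> hypercyclic Tf.
  exact: vanishing_hypercyclic.
have small (e : R) : 0 < e -> exists n, forall a : odometer_space alpha_ge2,
    (mu (cylinder n a) < e%:E)%E.
  by move=> e0; exact: small_cylinders mu_nonatomic e0.
tfae=> [/Li_Yorke_orbit[u u0 orbit]|sc|hc|[hc _]].
- have [B [mB B0 vB]] := small_orbit_vanishing Tf_comp u0 orbit.
  exact/hypercyclic_supercyclic/(vanish_hc B).
- have [B [mB B0 vB]] := supercyclic_vanishing Tf_comp small sc.
  exact: vanish_hc vB.
- by split => //; exact: periodic_points_dense.
exact: hypercyclic_Li_Yorke (Lpof1_neq0 k mu p_ge1) hc.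
Qed.
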